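(* The empirical regularizer $\hat R(\theta)$ satisfies $$\left\|\mathbb{E}[\nabla\hat R(\theta)] - \nabla R(\theta)\right\|_F^2 \lesssim n^{-2}.$$
   Context: Covariates $x_i\in\mathbb{R}^d$ i.i.d. $\mathcal{N}(0,\Sigma)$, $\Sigma$ full rank; $\theta=(A,B)$, $A\in\mathbb{R}^{p\times d}$, $B\in\mathbb{R}^{d\times d}$. $R(\theta)=\frac18\|\Sigma^{1/2}(A^{\top}A-B^{\top}\Sigma B)\Sigma^{1/2}\|_F^2$, and $\hat R(\theta)=\frac18\|\hat\Sigma^{1/2}(A^{\top}A-B^{\top}\hat\Sigma B)\hat\Sigma^{1/2}\|_F^2$ with $\hat\Sigma=\frac1n\sum_{i=1}^n x_ix_i^{\top}$; the expectation is over the samples at fixed $\theta$. $f(n)\lesssim g(n)$ means $f(n)\le Cg(n)$ for all sufficiently large $n$, with $C$ a constant (depending polynomially on $p,d,\|M\|_{\mathrm{op}},\|\Sigma\|_{\mathrm{op}}$ and on $\theta$). *)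

(* Defs.v *)
From HB Require Import structures.
From mathcomp Require Import all_boot all_order all_algebra.
From mathcomp Require Import all_classical all_reals all_analysis.
From mathcomp Require Import normal_distribution.

Set Implicit Arguments.
Unset Strict Implicit.
Unset Printing Implicit Defensive.

Import Order.TTheory GRing.Theory Num.Theory.
Local Open Scope classical_set_scope.
Local Open Scope ring_scope.

Section Defs.
Variable R : realType.

Definition frob2 m n (M : 'M[R]_(m, n)) : R := \sum_i \sum_j M i j ^+ 2.

Definition psd_mx n (S : 'M[R]_n) : Prop :=
  S^T = S /\ forall v : 'cV[R]_n, 0 <= (v^T *m S *m v) 0 0.
Definition pd_mx n (S : 'M[R]_n) : Prop :=
  S^T = S /\ forall v : 'cV[R]_n, v != 0 -> 0 < (v^T *m S *m v) 0 0.

(* the positive semidefinite square root S^{1/2} (exists and is unique for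
   S psd; default 0 otherwise) *)
Definition sqrtm n (S : 'M[R]_n) : 'M[R]_n :=
  xget 0 (fun Q : 'M[R]_n => psd_mx Q /\ Q *m Q = S).

(* the regularizer (1/8) || S^{1/2} (A^T A - B^T S B) S^{1/2} ||_F^2;
   R(theta) = reg Sigma A B and hatR(theta) = reg hatSigma A B *)
Definition reg p d (S : 'M[R]_d) (A : 'M[R]_(p, d)) (B : 'M[R]_d) : R :=
  8^-1 * frob2 (sqrtm S *m (A^T *m A - B^T *m S *m B) *m sqrtm S).

(* gradient with respect to theta = (A, B): matrices of partial derivatives *)
Definition gradA p d (f : 'M[R]_(p, d) -> 'M[R]_d -> R)
    (A : 'M[R]_(p, d)) (B : 'M[R]_d) : 'M[R]_(p, d) :=
  \matrix_(i, j) derive1 (fun t : R => f (A + t *: delta_mx i j) B) 0.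
Definition gradB p d (f : 'M[R]_(p, d) -> 'M[R]_d -> R)
    (A : 'M[R]_(p, d)) (B : 'M[R]_d) : 'M[R]_d :=
  \matrix_(i, j) derive1 (fun t : R => f A (B + t *: delta_mx i j)) 0.

Definition sample_cov d n (x : 'I_n -> 'cV[R]_d) : 'M[R]_d :=
  n%:R^-1 *: \sum_(i < n) (x i *m (x i)^T).

Section Prob.
Context {dT : measure_display} {T : measurableType dT} (P : probability T R).

(* X is a centered Gaussian random vector with covariance Sig (Sig pd):
   its coordinates are measurable, and every nonzero linear form t^T X is
   N(0, t^T Sig t)-distributed (Cramer-Wold definition). *)
Definition gaussian_vec d (X : T -> 'cV[R]_d) (Sig : 'M[R]_d) : Prop :=
  (forall k : 'I_d, measurable_fun setT (fun w => X w k 0)) /\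
  forall t : 'cV[R]_d, t != 0 -> forall B : set R, measurable B ->
    P [set w | (t^T *m X w) 0 0 \in B] =
    normal_prob 0 (Num.sqrt ((t^T *m Sig *m t) 0 0)) B.

(* mutual independence of the random vectors x_0, ..., x_{n-1}: product rule
   on measurable rectangles (a pi-system generating the Borel sigma-algebra
   of R^d) *)
Definition indep_vecs d n (x : 'I_n -> T -> 'cV[R]_d) : Prop :=
  forall B : 'I_n -> 'I_d -> set R, (forall i k, measurable (B i k)) ->
    P (\bigcap_(i in [set: 'I_n]) [set w | forall k, x i w k ord0 \in B i k]) =
    (\prod_(i < n) P [set w | forall k, x i w k ord0 \in B i k])%E.

Definition Emx m k (X : T -> 'M[R]_(m, k)) : 'M[R]_(m, k) :=
  \matrix_(i, j) fine ('E_P[fun w => X w i j]).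

End Prob.
End Defs.

(* Main.v *)
Require Import Defs.
From HB Require Import structures.
From mathcomp Require Import all_boot all_order all_algebra.
From mathcomp Require Import all_classical all_reals all_analysis.
From mathcomp Require Import measurable_realfun normal_distribution.
From mathcomp Require Import complex spectral ring lra.

(** With [M_S = A^T A - B^T S B], cyclicity of the trace turns the regularizer
    into [tr (M_S S M_S S) / 8], so that its gradient is the pair
    [A S M_S S / 2], [- S B S M_S S / 2]. The square root disappears, and each
    entry of the gradient is a linear combination of products of at most four
    entries of [S].

    Write the sample covariance as [Sig + D]. In a product of four entries the
    terms linear in [D] have mean zero, and the others are bounded by the
    second and fourth powers of the entries of [D]. These are means of [n]
    independent centered variables, hence have second and fourth moments
    [O(1/n)]. The bias of every entry of the gradient is therefore [O(1/n)],
    and its square [O(1/n^2)]. *)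

Set Implicit Arguments.
Unset Strict Implicit.
Unset Printing Implicit Defensive.

Import Order.TTheory GRing.Theory Num.Theory.
Local Open Scope classical_set_scope.
Local Open Scope ring_scope.

(** * Positive semidefinite square roots *)

(** The square root in [reg] is picked by [xget], so the trace formula rests on the existence of a
    root for every positive semidefinite matrix; a sample covariance may be singular, which rules
    out an argument for definite matrices only. The entries of [D] are dependent, and [gaussian_vec]
    describes single linear forms only. Polarization still gives the covariance; the other mixed
    products of coordinates, or of entries of [D], are bounded pointwise by sums of pure powers of
    their factors. This is why eighth moments of coordinates enter: the fourth power of
    [X_a X_b - Sig a b] splits into eighth powers. The moments themselves come from comparing normal
    densities of different standard deviations, all of total mass one, rather than from integration
    by parts. *)

Lemma interpolation (F : fieldType) (s : seq F) (f : F -> F) :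
  exists p : {poly F}, {in s, forall x, p.[x] = f x}.
Proof.
elim: s => [|x s [p ps]]; first by exists 0.
have [xs|xs] := boolP (x \in s).
  by exists p => y; rewrite inE => /orP[/eqP->|]; exact: ps.
(* Newton's step: [q] vanishes at the earlier nodes, so a multiple of it corrects the value at [x]
   alone. *)
pose q := \prod_(y <- s) ('X - y%:P).
have qx : q.[x] != 0 by rewrite -/(root q x) root_prod_XsubC.
exists (p + ((f x - p.[x]) / q.[x]) *: q) => y.
rewrite inE hornerD hornerZ => /orP[/eqP->|ys].
  by rewrite divfK// addrC subrK.
have /rootP -> : root q y by rewrite root_prod_XsubC.
by rewrite mulr0 addr0 ps.
Qed.

Section SquareRoot.
Variable R : realType.

Lemma mul_trmx_cV n (v : 'cV[R]_n) : (v^T *m v) 0 0 = \sum_i v i 0 ^+ 2.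
Proof. by rewrite mxE; apply: eq_bigr => i _; rewrite mxE expr2. Qed.

Lemma mul_trmx_cV_ge0 n (v : 'cV[R]_n) : 0 <= (v^T *m v) 0 0.
Proof. by rewrite mul_trmx_cV sumr_ge0// => i _; exact: sqr_ge0. Qed.

Lemma psd_eigenvalue_ge0 n (S : 'M[R]_n) (a : R) :
  psd_mx S -> eigenvalue S a -> 0 <= a.
Proof.
move=> [_ S0] /eigenvalueP[v vS v0].
have := S0 v^T; rewrite trmxK vS -scalemxAl mxE -{1}(trmxK v).
rewrite mul_trmx_cV pmulr_lge0// lt_def -mul_trmx_cV mul_trmx_cV_ge0 andbT.
apply: contra v0; rewrite mul_trmx_cV psumr_eq0 => [/allP v0|i _]; last exact: sqr_ge0.
apply/eqP/matrixP => i j; rewrite ord1 mxE; apply/eqP.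
by have := v0 j; rewrite mem_index_enum sqrf_eq0 mxE => /(_ isT).
Qed.

Lemma trmx_horner_mx n (S : 'M[R]_n.+1) (q : {poly R}) :
  S^T = S -> (horner_mx S q)^T = horner_mx S q.
Proof.
move=> ST; elim/poly_ind: q => [|q c IH]; first by rewrite rmorph0 trmx0.
rewrite rmorphD rmorphM /= horner_mx_X horner_mx_C linearD/= tr_scalar_mx.
rewrite trmx_mul ST IH; congr (_ + _); exact: comm_mx_horner.
Qed.

(* [S] is diagonalizable over [R[i]] with nonnegative real eigenvalues, so a
   polynomial that interpolates the fourth root there will do; the square of
   [r] evaluated at [S] is then visibly positive semidefinite. *)
Lemma psd_horner_root n (S : 'M[R]_n.+1) : psd_mx S ->
  exists r : {poly R}, horner_mx S (r ^+ 4) = S.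
Proof.
move=> Spsd; have [ST _] := Spsd.
pose f := real_complex R; pose SC := map_mx f S.
have SCn : SC \is hermsymmx.
  apply: realsym_hermsym.
    by apply/is_hermitianmxP; rewrite expr0 scale1r map_mx_id// /SC map_trmx ST.
  by apply/mxOverP => i j; rewrite mxE; apply/complex_realP; exists (S i j).
have [P [sp [Pu SCE spr]]] : exists (P : 'M[R[i]]_n.+1) (sp : 'rV[R[i]]_n.+1),
    [/\ P \is a GRing.unit, SC = invmx P *m diag_mx sp *m P &
        forall j, sp 0 j \is Num.real].
  exists (spectralmx SC), (spectral_diag SC); split.
  - exact: spectral_unit.
  - exact/orthomx_spectralP/hermitian_normalmx.
  - by move=> j; have /mxOverP := hermitian_spectral_diag_real SCn.
pose l j : R := complex.Re (sp 0 j).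
have fl j : f (l j) = sp 0 j by rewrite /f RRe_real.
have l0 j : 0 <= l j.
  (* The characteristic polynomial of [SC] is the image of that of [S], so a complex eigenvalue of
     the form [f (l j)] gives the real eigenvalue [l j] of [S]; row [j] of [P] is its
     eigenvector. *)
  apply: (psd_eigenvalue_ge0 Spsd); rewrite eigenvalue_root_char.
  rewrite -(fmorph_root f) map_char_poly -/SC -eigenvalue_root_char.
  apply/eigenvalueP; exists (row j P).
    rewrite -row_mul {1}SCE !mulmxA mulmxV// mul1mx row_mul row_diag_mx.
    by rewrite -scalemxAl -rowE; congr (_ *: _); exact/esym/fl.
  apply/eqP => Pj; have := congr1 (mulmx^~ (invmx P)) Pj.
  rewrite -row_mul mulmxV// mul0mx => /rowP/(_ j).
  by rewrite !mxE eqxx => /eqP; rewrite oner_eq0.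
have [r rE] := interpolation (codom l) (fun x => Num.sqrt (Num.sqrt x)).
exists r; apply: (@map_mx_inj _ _ f).
rewrite map_horner_mx -/SC; move: SC SCE {SCn} => SC ->.
rewrite horner_mx_uconjC// horner_mx_diag.
congr (_ *m diag_mx _ *m _); apply/rowP => j; rewrite mxE -fl.
rewrite horner_map/= horner_exp rE ?codom_f//; congr (f _).
by rewrite -[4%N]/(2 * 2)%N exprM !sqr_sqrtr// sqrtr_ge0.
Qed.

Lemma psd_sqrt_exists n (S : 'M[R]_n) : psd_mx S ->
  exists Q, psd_mx Q /\ Q *m Q = S.
Proof.
case: n S => [|n] S Spsd.
  by exists S; split=> //; rewrite [S]flatmx0 mulmx0.
have [r rE] := psd_horner_root Spsd.
have [ST _] := Spsd; have rT := trmx_horner_mx r ST.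
exists (horner_mx S (r ^+ 2)); split; last first.
  by rewrite -[LHS]/(_ * _) -rmorphM -exprD.
split => [|v]; first exact: trmx_horner_mx.
rewrite rmorphXn/= expr2 -[_ * _]/(_ *m _) -{1}rT mulmxA -trmx_mul -mulmxA.
exact: mul_trmx_cV_ge0.
Qed.

Lemma sqrtmP n (S : 'M[R]_n) : psd_mx S ->
  (sqrtm S)^T = sqrtm S /\ sqrtm S *m sqrtm S = S.
Proof.
move=> /psd_sqrt_exists ex; rewrite /sqrtm.
case: xgetP => [Q _ [[-> _] ->] //|noQ].
by case: ex => Q /noQ.
Qed.

End SquareRoot.

(** * The gradient of the regularizer *)

Section Gradient.
Variable R : realType.

Lemma frob2_trace m n (X : 'M[R]_(m, n)) : frob2 X = \tr (X *m X^T).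
Proof.
rewrite /frob2 /mxtrace; apply: eq_bigr => i _; rewrite mxE.
by apply: eq_bigr => j _; rewrite mxE expr2.
Qed.

Definition residual p d (S : 'M[R]_d) (A : 'M[R]_(p, d)) (B : 'M[R]_d) :=
  A^T *m A - B^T *m S *m B.

Lemma residual_sym p d (S : 'M[R]_d) (A : 'M[R]_(p, d)) (B : 'M[R]_d) :
  S^T = S -> (residual S A B)^T = residual S A B.
Proof. by move=> ST; rewrite linearB/= !trmx_mul !trmxK ST mulmxA. Qed.

Lemma reg_trace p d (S : 'M[R]_d) (A : 'M[R]_(p, d)) (B : 'M[R]_d) :
  psd_mx S ->
  reg S A B = 8^-1 * \tr (residual S A B *m S *m residual S A B *m S).
Proof.
move=> Sp; have [ST _] := Sp; have [QT QQ] := sqrtmP Sp.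
rewrite /reg frob2_trace -/(residual S A B) !trmx_mul QT residual_sym//.
set M := residual S A B; set Q := sqrtm S.
congr (_ * _); rewrite -!mulmxA mxtrace_mulC !mulmxA.
by rewrite -[in LHS](mulmxA M Q Q) QQ -[in LHS](mulmxA _ Q Q) QQ.
Qed.

(** Along a coordinate line the residual is at most quadratic in [t], so the regularizer is a
    polynomial of degree at most four there. *)
Lemma derive1_quartic (a b c e g : R) :
  derive1 (fun t : R => a + b * t + c * t ^+ 2 + e * t ^+ 3 + g * t ^+ 4) 0 = b.
Proof.
pose q := Poly [:: a; b; c; e; g].
have -> : (fun t : R => a + b * t + c * t ^+ 2 + e * t ^+ 3 + g * t ^+ 4) = horner q.
  by apply/funext => t; rewrite horner_Poly/=; ring.
by rewrite -derivE horner_coef0 coef_deriv coef_Poly.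
Qed.

(** The bilinear form [b] is symmetric by cyclicity of the trace, so the two cross terms of [M0] and
    [M1] coincide and turn [8^-1] into [4^-1]; [M2] enters only from [t ^+ 2] on. *)
Lemma derive1_quadratic_trace d (S M0 M1 M2 : 'M[R]_d) :
  derive1 (fun t : R => 8^-1 * \tr ((M0 + t *: M1 + t ^+ 2 *: M2) *m S *m
     (M0 + t *: M1 + t ^+ 2 *: M2) *m S)) 0 = 4^-1 * \tr (M1 *m S *m M0 *m S).
Proof.
pose b X Y := \tr (X *m S *m Y *m S).
have bC X Y : b X Y = b Y X by rewrite /b -mulmxA mxtrace_mulC mulmxA.
transitivity (derive1 (fun t : R => 8^-1 * b M0 M0 + (4^-1 * b M1 M0) * t +
   (8^-1 * (b M1 M1 + 2 * b M2 M0)) * t ^+ 2 + (4^-1 * b M1 M2) * t ^+ 3 +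
   (8^-1 * b M2 M2) * t ^+ 4) 0); last exact: derive1_quartic.
congr (derive1 _ 0); apply/funext => t.
rewrite !mulmxDl !mulmxDr !mulmxDl -!scalemxAl -!scalemxAr -!scalemxAl.
rewrite !linearD !linearZ/= -!/(b _ _).
rewrite (bC M0 M1) (bC M0 M2) (bC M2 M1); by field.
Qed.

(** Turns a directional derivative, a trace against an elementary matrix, into an entry of the
    gradient. *)
Lemma trace_delta_mul p d (X : 'M[R]_(p, d)) i j :
  \tr ((delta_mx i j)^T *m X) = X i j.
Proof.
rewrite trmx_delta /mxtrace (bigD1 j)//= mxE (bigD1 i)//= big1 => [|k ki].
  rewrite !mxE !eqxx mul1r addr0 big1 ?addr0// => l lj.
  rewrite mxE big1// => k _; rewrite !mxE (negPf lj) mul0r//.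
by rewrite !mxE (negPf ki) andbF mul0r.
Qed.

Lemma gradA_reg p d (S : 'M[R]_d) (A : 'M[R]_(p, d)) (B : 'M[R]_d) :
  psd_mx S -> gradA (@reg R p d S) A B = 2^-1 *: (A *m S *m residual S A B *m S).
Proof.
move=> Sp; have [ST _] := Sp; apply/matrixP => i j; rewrite [LHS]mxE [RHS]mxE.
set E := delta_mx i j; set M0 := residual S A B.
have MT : M0^T = M0 by exact: residual_sym.
transitivity (derive1 (fun t : R => 8^-1 * \tr (
    (M0 + t *: (E^T *m A + A^T *m E) + t ^+ 2 *: (E^T *m E)) *m S *m
    (M0 + t *: (E^T *m A + A^T *m E) + t ^+ 2 *: (E^T *m E)) *m S)) 0).
  congr (derive1 _ 0); apply/funext => t; rewrite reg_trace//.
  suff -> : residual S (A + t *: E) B =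
     M0 + t *: (E^T *m A + A^T *m E) + t ^+ 2 *: (E^T *m E) by [].
  rewrite /residual [(A + _)^T]linearD/= [(t *: E)^T]linearZ/= mulmxDl !mulmxDr -!scalemxAl -!scalemxAr.
  rewrite /M0 /residual scalerDr scalerA -expr2 -!addrA; congr (_ + _).
  by rewrite [RHS]addrC -!addrA addrCA.
rewrite derive1_quadratic_trace !mulmxDl linearD/=.
(* The two halves of the derivative are transposes of each other up to cyclicity, which doubles
   [4^-1] to [2^-1]. *)
have -> : \tr (A^T *m E *m S *m M0 *m S) = \tr (E^T *m A *m S *m M0 *m S).
  rewrite -mxtrace_tr !trmx_mul trmxK ST MT -!mulmxA mxtrace_mulC -!mulmxA.
  by rewrite mxtrace_mulC -!mulmxA mxtrace_mulC -!mulmxA.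
rewrite -!mulmxA trace_delta_mul; by field.
Qed.

Lemma gradB_reg p d (S : 'M[R]_d) (A : 'M[R]_(p, d)) (B : 'M[R]_d) :
  psd_mx S ->
  gradB (@reg R p d S) A B = - 2^-1 *: (S *m B *m S *m residual S A B *m S).
Proof.
move=> Sp; have [ST _] := Sp; apply/matrixP => i j; rewrite [LHS]mxE [RHS]mxE.
set E := delta_mx i j; set M0 := residual S A B.
have MT : M0^T = M0 by exact: residual_sym.
transitivity (derive1 (fun t : R => 8^-1 * \tr (
    (M0 + t *: (- (E^T *m (S *m B) + B^T *m S *m E)) + t ^+ 2 *: (- (E^T *m S *m E))) *m S *m
    (M0 + t *: (- (E^T *m (S *m B) + B^T *m S *m E)) + t ^+ 2 *: (- (E^T *m S *m E))) *m S)) 0).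
  congr (derive1 _ 0); apply/funext => t; rewrite reg_trace//.
  suff -> : residual S A (B + t *: E) =
     M0 + t *: (- (E^T *m (S *m B) + B^T *m S *m E)) + t ^+ 2 *: (- (E^T *m S *m E)) by [].
  rewrite /residual [(B + _)^T]linearD/= [(t *: E)^T]linearZ/= !mulmxDl !mulmxDr -!scalemxAl -!scalemxAr.
  rewrite /M0 /residual !scalerN scalerDr scalerA -expr2 !opprD -!addrA; congr (_ + (_ + _)).
  by rewrite addrCA mulmxA.
rewrite derive1_quadratic_trace !mulNmx !mulmxDl linearN linearD/=.
have -> : \tr (B^T *m S *m E *m S *m M0 *m S) = \tr (E^T *m (S *m B) *m S *m M0 *m S).
  rewrite -mxtrace_tr !trmx_mul trmxK ST MT -!mulmxA mxtrace_mulC -!mulmxA.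
  by rewrite mxtrace_mulC -!mulmxA mxtrace_mulC -!mulmxA.
rewrite -!mulmxA trace_delta_mul; by field.
Qed.

End Gradient.

(** * Moments of the normal distribution *)

Section NormalMoments.
Variable R : realType.
Local Notation mu := (@lebesgue_measure R).

(** Change of variables holds for the Radon-Nikodym derivative; the density equals it almost
    everywhere because both have the same integral over every measurable set. *)
Lemma ge0_integral_normal_prob (s : R) (f : R -> \bar R) :
  measurable_fun [set: R] f -> (forall x, 0 <= f x)%E ->
  (\int[normal_prob 0 s]_x f x = \int[mu]_x (f x * (normal_pdf 0 s x)%:E))%E.
Proof.
move=> mf f0; have dom := normal_prob_dominates (0:R) s.
rewrite -(Radon_Nikodym_SigmaFinite.change_of_variables dom f0 measurableT mf).
have hi := Radon_Nikodym_SigmaFinite.f_integrable dom.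
apply: ae_eq_integral => //.
- by apply: emeasurable_funM => //; exact: (measurable_int mu).
- by apply: emeasurable_funM => //; apply/measurable_EFinP; exact: measurable_normal_pdf.
- apply: ae_eqe_mul2l; apply: integral_ae_eq => //.
  + by apply/measurable_EFinP; exact: measurable_normal_pdf.
  + by move=> E _ mE; rewrite -Radon_Nikodym_SigmaFinite.f_integral.
Qed.

(** The source of all Gaussian moments below: [r = 2^-1] bounds the even ones, and letting [r] vary
    around [1] pins down the variance. *)
Lemma normal_pdf_rescale (s r x : R) : s != 0 -> 0 < r ->
  normal_pdf 0 (s / r) x =
  r * normal_pdf 0 s x * expR ((1 - r ^+ 2) * x ^+ 2 / (2 * s ^+ 2)).
Proof.
move=> s0 r0; have rn0 : r != 0 by rewrite gt_eqF.
have pdfE t : t != 0 -> normal_pdf 0 t x = normal_peak t * normal_fun 0 t x.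
  by move=> t0; rewrite normal_pdfE.
rewrite !pdfE ?mulf_neq0 ?invr_eq0// /normal_fun /normal_peak.
rewrite [r * (_ * _)]mulrA -[RHS]mulrA.
rewrite -expRD; congr (_ * expR _).
  have -> : (s / r) ^+ 2 * pi *+ 2 = r^-1 ^+ 2 * (s ^+ 2 * pi *+ 2).
    by field.
  by rewrite sqrtrM ?sqr_ge0// sqrtr_sqr gtr0_norm ?invr_gt0// invfM invrK.
by field; apply/andP.
Qed.

Lemma exp_dominates_pow (x : R) k : 0 <= x -> x ^+ k <= k`!%:R * expR x.
Proof.
move=> x0; case: k => [|k].
  by rewrite expr0 fact0 mul1r -expR0 ler_expR.
rewrite mulrC -ler_pdivrMr ?ltr0n ?fact_gt0//.
by apply: le_trans (expR_ge1Dxn k x0); rewrite lerDr.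
Qed.

(* [s / 2^-1 = 2 s]: the density of standard deviation [2 s] absorbs the
   power, at the cost of the factor [2]. *)
Lemma pow_normal_pdf_le (s x : R) k : s != 0 ->
  x ^+ (2 * k) * normal_pdf 0 s x <=
  2 * k`!%:R * (3 * s ^+ 2) ^+ k * normal_pdf 0 (s / 2^-1) x.
Proof.
move=> s0; rewrite normal_pdf_rescale//.
set u : R := (1 - 2^-1 ^+ 2) * x ^+ 2 / (2 * s ^+ 2).
have s2 : 0 < s ^+ 2 by rewrite exprn_even_gt0.
have u0 : 0 <= u.
  have -> : u = 3 / 8 * (x ^+ 2 / s ^+ 2) by rewrite /u; field.
  by rewrite mulr_ge0 ?divr_ge0 ?sqr_ge0.
(* Exactly, [x ^+ 2] is [8 / 3 * s ^+ 2 * u]; the constant is rounded up to [3]. *)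
have xu : x ^+ 2 <= 3 * s ^+ 2 * u.
  have -> : 3 * s ^+ 2 * u = 9 / 8 * x ^+ 2 by rewrite /u; field.
  by have := sqr_ge0 x; lra.
have -> : 2 * k`!%:R * (3 * s ^+ 2) ^+ k * (2^-1 * normal_pdf 0 s x * expR u) =
  (3 * s ^+ 2) ^+ k * (k`!%:R * expR u) * normal_pdf 0 s x by field.
apply: ler_wpM2r; first exact: normal_pdf_ge0.
apply: (@le_trans _ _ ((3 * s ^+ 2 * u) ^+ k)).
  by rewrite exprM lerXn2r// nnegrE ?sqr_ge0// mulr_ge0// mulr_ge0// ltW.
rewrite [(_ * u) ^+ k]exprMn ler_wpM2l//; last exact: exp_dominates_pow.
by rewrite exprn_ge0// mulr_ge0// sqr_ge0.
Qed.

Lemma normal_moment_le (s : R) k : s != 0 ->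
  (\int[normal_prob 0 s]_x (x ^+ (2 * k))%:E <=
   (2 * k`!%:R * (3 * s ^+ 2) ^+ k)%:E)%E.
Proof.
move=> s0; rewrite ge0_integral_normal_prob; last 2 first.
- by apply/measurable_EFinP; exact: measurable_funX.
- by move=> x; rewrite lee_fin exprM exprn_ge0// sqr_ge0.
set c := 2 * _ * _.
have c0 : 0 <= c by rewrite mulr_ge0 ?mulr_ge0// exprn_ge0// mulr_ge0// sqr_ge0.
have -> : c%:E = (\int[mu]_x (c%:E * (normal_pdf 0 (s / 2^-1) x)%:E))%E.
  rewrite ge0_integralZl ?integral_normal_pdf ?mule1//.
  - by apply/measurable_EFinP; exact: measurable_normal_pdf.
  - by move=> x _; rewrite lee_fin normal_pdf_ge0.
apply: ge0_le_integral => //.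
- by move=> x _; rewrite lee_fin mulr_ge0 ?normal_pdf_ge0// exprM exprn_ge0// sqr_ge0.
- by apply: emeasurable_funM; apply/measurable_EFinP; [exact: measurable_funX|exact: measurable_normal_pdf].
- by apply: emeasurable_funM; apply/measurable_EFinP => //; exact: measurable_normal_pdf.
- by move=> x _; rewrite -!EFinM lee_fin; exact: pow_normal_pdf_le.
Qed.

(** The left side equals [1] at [r = 1], which is therefore a maximum, and its derivative there is
    [1 - 2 * v]. The proof replaces the derivative by explicit points that violate the bound. *)
Lemma tangent_at_one (v : R) :
  (forall r, 0 < r -> r + r * (1 - r ^+ 2) * v <= 1) -> v = 2^-1.
Proof.
move=> H; have [v12|v12|//] := ltrgtP v 2^-1.
- have [v0|v0] := ltP v 0.
    by have := H 2 ltac:(lra); nra.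
  (* At [r = 1 + e] the excess over [1] is [e * (1 - (1 + e) * (2 + e) * v)]; this [e] is small
     enough to keep it positive. *)
  pose e := (1 - 2 * v) / 4.
  have e0 : 0 < e by rewrite /e; lra.
  have : (1 + e) * (2 + e) * v < 1 by have : e <= 4^-1 by [rewrite /e; lra]; rewrite /e in e0 *; nra.
  have := H (1 + e) ltac:(lra).
  nra.
(* At [r = 1 - e] the excess is [e * (2 * v - 1 - 3 * e * v + e ^+ 2 * v)], and this [e] makes
   [3 * e * v] half of [2 * v - 1]. *)
- pose e := (2 * v - 1) / (6 * v).
  have e0 : 0 < e by rewrite /e divr_gt0; lra.
  have ev : e * (6 * v) = 2 * v - 1 by rewrite /e; field; lra.
  have e1 : e < 1 by nra.
  have := H (1 - e) ltac:(lra).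
  nra.
Qed.

(* Bounding the exponential in [normal_pdf_rescale] from below by its tangent
   and integrating gives the hypothesis of [tangent_at_one]. *)
Lemma normal_second_moment (s : R) : s != 0 ->
  (\int[normal_prob 0 s]_x (x ^+ 2)%:E = (s ^+ 2)%:E)%E.
Proof.
move=> s0; have s2 : 0 < s ^+ 2 by rewrite exprn_even_gt0.
rewrite ge0_integral_normal_prob; last 2 first.
- by apply/measurable_EFinP; exact: measurable_funX.
- by move=> x; rewrite lee_fin sqr_ge0.
pose f x := (x ^+ 2 * normal_pdf 0 s x).
have f0 x : 0 <= f x by rewrite mulr_ge0 ?sqr_ge0 ?normal_pdf_ge0.
have mf : measurable_fun [set: R] (EFin \o f).
  by apply/measurable_EFinP/measurable_funM; [exact: measurable_funX|exact: measurable_normal_pdf].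
(* For [r > 1] the tangent bound takes both signs, so splitting its integral requires finiteness
   beforehand; the bound on even moments supplies it. *)
have fi : mu.-integrable [set: R] (EFin \o f).
  apply/integrableP; split => //.
  under eq_integral do rewrite gee0_abs ?lee_fin//.
  have := normal_moment_le 1 s0; rewrite ge0_integral_normal_prob; last 2 first.
  - by apply/measurable_EFinP; exact: measurable_funX.
  - by move=> x; rewrite lee_fin muln1 sqr_ge0.
  by move=> /le_lt_trans; apply; exact: ltry.
have Jfin := integrable_fin_num measurableT fi.
set J := (\int[mu]_x _)%E in Jfin.
rewrite -[LHS]/J -(fineK Jfin); congr EFin.
suff : fine J / (2 * s ^+ 2) = 2^-1.
  move/(congr1 ( *%R^~ (2 * s ^+ 2))); rewrite divfK; last by rewrite mulf_neq0 ?gt_eqF.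
  by move=> ->; field.
apply: tangent_at_one => r r0.
pose c := r * (1 - r ^+ 2) / (2 * s ^+ 2).
have pi := integrable_normal_pdf (0:R) s.
have : (\int[mu]_x (r%:E * (normal_pdf 0 s x)%:E + c%:E * (f x)%:E) <=
  \int[mu]_x (normal_pdf 0 (s / r) x)%:E)%E.
  apply: le_integral => //.
  - by apply: integrableD => //; apply: integrableZl.
  - exact: integrable_normal_pdf.
  - move=> x _; rewrite -!EFinM -EFinD lee_fin normal_pdf_rescale//.
    have -> : r * normal_pdf 0 s x + c * f x = r * normal_pdf 0 s x *
      (1 + (1 - r ^+ 2) * x ^+ 2 / (2 * s ^+ 2)) by rewrite /c /f; field; rewrite s0.
    by rewrite ler_wpM2l ?expR_ge1Dx// mulr_ge0 ?normal_pdf_ge0// ltW.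
rewrite integral_normal_pdf integralD//; try exact: integrableZl.
rewrite !integralZl// integral_normal_pdf mule1 -/J -(fineK Jfin).
by rewrite -EFinM -EFinD lee_fin /c -!mulrA [fine J * _]mulrC.
Qed.

End NormalMoments.

(** * Random variables with finite moments *)

Section Moments.
Context (R : realType) (dT : measure_display) (T : measurableType dT).
Variable P : probability T R.
Implicit Types f g : T -> R.

(** A class closed under sums and products, so that every polynomial in the samples is integrable at
    once. Even powers keep the integrands nonnegative without absolute values. *)
Definition finite_moments f :=
  measurable_fun [set: T] f /\
  forall k, (\int[P]_w (f w ^+ (2 * k))%:E < +oo)%E.

Definition expect f : R := \int[P]_w f w.

Lemma even_pow_ge0 (x : R) k : 0 <= x ^+ (2 * k).
Proof. by rewrite exprM exprn_ge0// sqr_ge0. Qed.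

Lemma finite_momentsP f : measurable_fun [set: T] f ->
  (forall k, exists g : T -> \bar R, [/\ measurable_fun [set: T] g,
     (\int[P]_w g w < +oo)%E & forall w, ((f w ^+ (2 * k))%:E <= g w)%E]) ->
  finite_moments f.
Proof.
move=> mf H; split=> // k; have [g [mg gy fg]] := H k.
apply: le_lt_trans gy; apply: ge0_le_integral => //.
- by move=> w _; rewrite lee_fin even_pow_ge0.
- by apply/measurable_EFinP; exact: measurable_funX.
Qed.

Lemma measurable_even_pow f k : measurable_fun [set: T] f ->
  measurable_fun [set: T] (fun w => (f w ^+ (2 * k))%:E).
Proof. by move=> mf; apply/measurable_EFinP; exact: measurable_funX. Qed.

Lemma finite_moments_cst c : finite_moments (fun=> c).
Proof.
apply: finite_momentsP => // k; exists (cst (c ^+ (2 * k))%:E); split => //.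
by rewrite integral_cst//= probability_setT mule1 ltry.
Qed.

Lemma finite_momentsM f g :
  finite_moments f -> finite_moments g -> finite_moments (fun w => f w * g w).
Proof.
move=> [mf f1] [mg g1]; apply: finite_momentsP => [|k].
  exact: measurable_funM.
exists (fun w => (f w ^+ (2 * (2 * k)))%:E + (g w ^+ (2 * (2 * k)))%:E)%E.
split.
- by apply: emeasurable_funD; exact: measurable_even_pow.
- rewrite ge0_integralD//; first exact: lte_add_pinfty.
  + by move=> w _; rewrite lee_fin even_pow_ge0.
  + exact: measurable_even_pow.
  + by move=> w _; rewrite lee_fin even_pow_ge0.
  + exact: measurable_even_pow.
- move=> w; rewrite -EFinD lee_fin exprMn ![(2 * (2 * k))%N]mulnC ![_ ^+ (2 * k * 2)]exprM.
  by nra.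
Qed.

(** The square of a sum is at most four times the larger square; comparing with the larger one
    replaces a binomial expansion and yields the factor [4 ^+ k]. *)
Lemma finite_momentsD f g :
  finite_moments f -> finite_moments g -> finite_moments (fun w => f w + g w).
Proof.
move=> [mf f1] [mg g1]; apply: finite_momentsP => [|k].
  exact: measurable_funD.
exists (fun w => (4 ^+ k)%:E * ((f w ^+ (2 * k))%:E + (g w ^+ (2 * k))%:E))%E.
have m0 : measurable_fun [set: T]
    (fun w => (f w ^+ (2 * k))%:E + (g w ^+ (2 * k))%:E)%E.
  by apply: emeasurable_funD; exact: measurable_even_pow.
split.
- exact: emeasurable_funM.
- rewrite ge0_integralZl//.
  + rewrite ge0_integralD//; first by apply: lte_mul_pinfty; rewrite ?lee_fin ?exprn_ge0//; exact: lte_add_pinfty.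
    * by move=> w _; rewrite lee_fin even_pow_ge0.
    * exact: measurable_even_pow.
    * by move=> w _; rewrite lee_fin even_pow_ge0.
    * exact: measurable_even_pow.
  + by move=> w _; rewrite -EFinD lee_fin addr_ge0// even_pow_ge0.
- move=> w; rewrite -EFinD -EFinM lee_fin !exprM mulrDr -!exprMn.
  have H (x y : R) : x ^+ 2 <= y ^+ 2 ->
      ((x + y) ^+ 2) ^+ k <= (4 * x ^+ 2) ^+ k + (4 * y ^+ 2) ^+ k.
    have y4 : 0 <= 4 * y ^+ 2 by have := sqr_ge0 y; lra.
    have x4 : 0 <= 4 * x ^+ 2 by have := sqr_ge0 x; lra.
    move=> xy; apply: (@le_trans _ _ ((4 * y ^+ 2) ^+ k)).
      apply: lerXn2r; rewrite ?nnegrE ?sqr_ge0//.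
      by have := sqr_ge0 (x - y); nra.
    by rewrite lerDr exprn_ge0.
  have [/H//|/ltW/H] := leP (f w ^+ 2) (g w ^+ 2).
  by rewrite (addrC (g w)) [leRHS]addrC.
Qed.

Lemma finite_momentsZ c f : finite_moments f -> finite_moments (fun w => c * f w).
Proof. by move=> mf; apply: finite_momentsM => //; exact: finite_moments_cst. Qed.

Lemma finite_momentsB f g :
  finite_moments f -> finite_moments g -> finite_moments (fun w => f w - g w).
Proof.
move=> mf mg; have := finite_momentsD mf (finite_momentsZ (-1) mg).
by under eq_fun do rewrite mulN1r.
Qed.

Lemma finite_momentsX f k : finite_moments f -> finite_moments (fun w => f w ^+ k).
Proof.
move=> mf; elim: k => [|k IH].
  by under eq_fun do rewrite expr0; exact: finite_moments_cst.
by under eq_fun do rewrite exprS; exact: finite_momentsM.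
Qed.

Lemma finite_moments_sum (I : Type) (r : seq I) (Q : pred I) (F : I -> T -> R) :
  (forall i, finite_moments (F i)) ->
  finite_moments (fun w => \sum_(i <- r | Q i) F i w).
Proof.
move=> mF; elim: r => [|i r IH].
  by under eq_fun do rewrite big_nil; exact: finite_moments_cst.
under eq_fun do rewrite big_cons.
by case: (Q i) => //; exact: finite_momentsD.
Qed.

Lemma finite_moments_integrable f :
  finite_moments f -> P.-integrable [set: T] (EFin \o f).
Proof.
move=> [mf f1]; apply/integrableP; split; first exact/measurable_EFinP.
apply: (@le_lt_trans _ _ (\int[P]_w (1 + (f w ^+ (2 * 1))%:E)))%E; last first.
  rewrite ge0_integralD//.
  - by rewrite integral_cst//= mul1e probability_setT lte_add_pinfty// ltry.
  - by move=> w _; rewrite lee_fin even_pow_ge0.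
  - exact: measurable_even_pow.
apply: ge0_le_integral => //.
- by apply: measurableT_comp => //; exact/measurable_EFinP.
- by apply: emeasurable_funD => //; exact: measurable_even_pow.
- move=> w _; rewrite -EFinD lee_fin muln1 /=.
  by have [] := ger0P (f w); nra.
Qed.

Lemma expectD f g : finite_moments f -> finite_moments g ->
  expect (fun w => f w + g w) = expect f + expect g.
Proof. by move=> mf mg; rewrite /expect RintegralD//; exact: finite_moments_integrable. Qed.

Lemma expectB f g : finite_moments f -> finite_moments g ->
  expect (fun w => f w - g w) = expect f - expect g.
Proof. by move=> mf mg; rewrite /expect RintegralB//; exact: finite_moments_integrable. Qed.

Lemma expectZ c f : finite_moments f -> expect (fun w => c * f w) = c * expect f.
Proof. by move=> mf; rewrite /expect RintegralZl//; exact: finite_moments_integrable. Qed.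

Lemma expect_cst c : expect (fun=> c) = c.
Proof. by rewrite /expect Rintegral_cst//= probability_setT mulr1. Qed.

Lemma expect_le f g : finite_moments f -> finite_moments g ->
  (forall w, f w <= g w) -> expect f <= expect g.
Proof.
by move=> mf mg fg; apply: le_Rintegral => //; exact: finite_moments_integrable.
Qed.

Lemma expect_norm_le f g : finite_moments f -> finite_moments g ->
  (forall w, `|f w| <= g w) -> `|expect f| <= expect g.
Proof.
move=> mf mg fg; rewrite ler_norml -mulN1r -expectZ//; apply/andP; split.
  apply: expect_le => // [|w]; first exact: finite_momentsZ.
  by have := fg w; rewrite mulN1r ler_norml => /andP[].
by apply: expect_le => // w; exact: le_trans (ler_norm _) (fg w).
Qed.

Lemma expect_sum (I : Type) (r : seq I) (Q : pred I) (F : I -> T -> R) :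
  (forall i, finite_moments (F i)) ->
  expect (fun w => \sum_(i <- r | Q i) F i w) = \sum_(i <- r | Q i) expect (F i).
Proof.
move=> mF; elim: r => [|i r IH].
  by under [in LHS]eq_fun do rewrite big_nil; rewrite expect_cst big_nil.
under [in LHS]eq_fun do rewrite big_cons.
rewrite big_cons; case: (Q i) => //.
by rewrite expectD ?IH//; exact: finite_moments_sum.
Qed.

End Moments.

(** * Independence *)

Section Independence.
Context (R : realType) (dT : measure_display) (T : measurableType dT).
Variable P : probability T R.

Definition indep_systems (G1 G2 : set (set T)) :=
  forall A B, G1 A -> G2 B -> P (A `&` B) = (P A * P B)%E.

Lemma indep_systems_sym G1 G2 : indep_systems G1 G2 -> indep_systems G2 G1.
Proof. by move=> H A B GA GB; rewrite setIC muleC H. Qed.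

(** For fixed [B], the maps sending [A] to [P (A]&[B)] and to [P A * P B] are finite measures that
    agree on a pi-system, hence on the sigma-algebra it generates. *)
Lemma indep_systems_sigmal (G1 G2 : set (set T)) :
  G1 `<=` measurable -> G2 `<=` measurable -> setI_closed G1 -> G1 setT ->
  indep_systems G1 G2 -> indep_systems <<s G1 >> G2.
Proof.
move=> m1 m2 I1 T1 H A B GA GB.
have PB : P B \is a fin_num by exact/fin_num_measure/m2.
have r0 : 0 <= fine (P B) by rewrite fine_ge0.
pose r : {nonneg R} := NngNum r0.
have : mrestr P (m2 _ GB) A = mscale r P A.
  apply: (g_sigma_algebra_measure_unique G1 _ (fun=> setT)) => //.
  - by rewrite bigcup_const.
  - by move=> C GC; rewrite /mrestr/= /mscale/= fineK// muleC; exact: H.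
  - by move=> k; rewrite /= /mrestr setTI -ge0_fin_numE.
by rewrite /mrestr/= /mscale/= fineK// muleC.
Qed.

Lemma indep_systems_sigma (G1 G2 : set (set T)) :
  G1 `<=` measurable -> G2 `<=` measurable ->
  setI_closed G1 -> setI_closed G2 -> G1 setT -> G2 setT ->
  indep_systems G1 G2 -> indep_systems <<s G1 >> <<s G2 >>.
Proof.
move=> m1 m2 I1 I2 T1 T2 H.
have sm1 : <<s G1 >> `<=` measurable.
  exact: smallest_sub (@sigma_algebra_measurable _ T) m1.
apply: indep_systems_sym; apply: indep_systems_sigmal => //.
by apply: indep_systems_sym; exact: indep_systems_sigmal.
Qed.

(** By uniqueness of the product measure, the law of the pair is the product of the two laws; Fubini
    then splits the integral. *)
Lemma expectM_indep (f g : T -> R) : finite_moments P f -> finite_moments P g ->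
  (forall A B, measurable A -> measurable B ->
     P (f @^-1` A `&` g @^-1` B) = (P (f @^-1` A) * P (g @^-1` B))%E) ->
  expect P (fun w => f w * g w) = expect P f * expect P g.
Proof.
move=> fm gm fgP; have [mf _] := fm; have [mg _] := gm.
pose X : {mfun T >-> R} := mfun_Sub (mem_set mf).
pose Y : {mfun T >-> R} := mfun_Sub (mem_set mg).
have mXY : measurable_fun [set: T] (fun w => (f w, g w)).
  exact: measurable_fun_pair.
pose XY : {mfun T >-> (R * R)%type} := mfun_Sub (mem_set mXY).
have eqm A : measurable A ->
    (distribution P X \x distribution P Y)%E A = distribution P XY A.
  apply: product_measure_unique => B C mB mC.
  by rewrite /distribution /pushforward/= -fgP.
have mM : measurable_fun [set: R * R] (fun z : R * R => (z.1 * z.2)%:E).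
  by apply/measurable_EFinP; exact: measurable_funM.
have fgi := finite_moments_integrable (finite_momentsM fm gm).
have Mi : (distribution P X \x distribution P Y)%E.-integrable [set: R * R]
    (fun z : R * R => (z.1 * z.2)%:E).
  apply/integrableP; split => //.
  rewrite (eq_measure_integral (distribution P XY)); last by move=> A mA _; exact: eqm.
  rewrite ge0_integral_distribution//; last exact: measurableT_comp.
  by case/integrableP : fgi.
have law_integrable h (hm : measurable_fun [set: T] h) : finite_moments P h ->
    (distribution P (mfun_Sub (mem_set hm) : {mfun T >-> R})).-integrable
      [set: R] (EFin \o id).
  move=> fh; apply/integrableP; split; first exact/measurable_EFinP.
  rewrite ge0_integral_distribution//; last first.
    by apply: measurableT_comp => //; exact/measurable_EFinP.
  by have /integrableP[] := finite_moments_integrable fh.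
have law_integral h (hm : measurable_fun [set: T] h) : finite_moments P h ->
   (\int[distribution P (mfun_Sub (mem_set hm) : {mfun T >-> R})]_y (EFin \o id) y =
    (expect P h)%:E)%E.
  move=> fh; have hi := finite_moments_integrable fh.
  rewrite integral_distribution//; last exact/measurable_EFinP.
  by rewrite /expect /Rintegral fineK//; exact: integrable_fin_num.
apply: EFin_inj; rewrite EFinM.
transitivity (\int[distribution P XY]_z (z.1 * z.2)%:E)%E.
  rewrite integral_distribution// /expect /Rintegral fineK//.
  exact: integrable_fin_num.
rewrite (eq_measure_integral (distribution P X \x distribution P Y)%E); last first.
  by move=> A mA _; exact/esym/eqm.
rewrite -integral12_prod_meas1// /fubini_F/=.
under eq_integral.
  move=> x _; under eq_integral do rewrite EFinM.
  rewrite integralZl//; last exact: law_integrable.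
  rewrite law_integral//.
  over.
by rewrite integralZr ?law_integral//; exact: law_integrable.
Qed.

End Independence.

Section VectorIndependence.
Context (R : realType) (dT : measure_display) (T : measurableType dT).
Variable P : probability T R.
Variables (d n : nat) (x : 'I_n -> T -> 'cV[R]_d).
Hypothesis mx : forall i k, measurable_fun [set: T] (fun w => x i w k 0).
Hypothesis ix : indep_vecs P x.

Definition box (J : pred 'I_n) (B : 'I_n -> 'I_d -> set R) : set T :=
  [set w | forall i, J i -> forall k, x i w k 0 \in B i k].

(** A pi-system that generates the events depending only on the vectors with index in [J]. *)
Definition boxes (J : pred 'I_n) : set (set T) :=
  [set A | exists2 B, (forall i k, measurable (B i k)) & A = box J B].

Lemma boxes_setT J : boxes J setT.
Proof.
by exists (fun _ _ => setT) => //; apply/seteqP; split => // w _ i _ k; rewrite inE.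
Qed.

Lemma boxes_setI J : setI_closed (boxes J).
Proof.
move=> _ _ [B mB ->] [C mC ->]; exists (fun i k => B i k `&` C i k).
  by move=> i k; exact: measurableI.
apply/seteqP; split => w.
  by move=> [wB wC] i Ji k; rewrite in_setI wB ?wC.
by move=> wBC; split => i Ji k; have := wBC i Ji k; rewrite in_setI => /andP[].
Qed.

Lemma measurable_vec_box i (B : 'I_d -> set R) : (forall k, measurable (B k)) ->
  measurable [set w | forall k, x i w k 0 \in B k].
Proof.
move=> mB.
have -> : [set w | forall k, x i w k 0 \in B k] =
    \bigcap_(k in [set: 'I_d]) ((fun w => x i w k 0) @^-1` B k).
  by apply/seteqP; split => w /= wB k => [_|]; [exact: set_mem (wB k)|apply: mem_set; exact: wB].
apply: fin_bigcap_measurable => // k _; rewrite -[X in measurable X]setTI.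
exact: mx.
Qed.

(** Padding the indices outside [J] by the whole line gives the shape required by [indep_vecs],
    which constrains all indices at once. *)
Lemma boxE J B : box J B =
  \bigcap_(i in [set: 'I_n]) [set w | forall k, x i w k 0 \in
     (if J i then B i else fun=> setT) k].
Proof.
apply/seteqP; split => w wB i.
  by move=> _ k /=; case: ifP => [Ji|_]; [exact: wB|rewrite inE].
by move=> Ji k; have := wB i I k; rewrite Ji.
Qed.

Lemma boxes_measurable J : boxes J `<=` measurable.
Proof.
move=> _ [B mB ->]; rewrite boxE; apply: fin_bigcap_measurable => // i _.
by apply: measurable_vec_box => k; case: ifP.
Qed.

(** The three padded products are compared index by index: [J] and [K] being disjoint, at least one
    of the two factors on the right has probability one. *)
Lemma indep_boxes (J K : pred 'I_n) : (forall i, J i -> ~~ K i) ->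
  indep_systems P (boxes J) (boxes K).
Proof.
move=> JK _ _ [B mB ->] [C mC ->].
have -> : box J B `&` box K C =
    box predT (fun i => if J i then B i else if K i then C i else fun=> setT).
  apply/seteqP; split => w.
    move=> [wB wC] i _ k; case: ifPn => [Ji|_]; first exact: wB.
    by case: ifPn => [Ki|_]; [exact: wC|rewrite inE].
  move=> wBC; split => i Hi k; have := wBC i isT k; first by rewrite Hi.
  by case: ifPn => [/JK|_]; rewrite Hi.
rewrite !boxE !ix; last 3 first.
- by move=> i k; case: ifP.
- by move=> i k; case: ifP.
- by move=> i k /=; case: ifP => // _; case: ifP.
rewrite -big_split/=; apply: eq_bigr => i _.
have PT : P [set w | forall k : 'I_d, x i w k 0 \in [set: R]] = 1%E.
  rewrite -(@probability_setT _ _ _ P); congr (P _).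
  by apply/seteqP; split => // w _ k; rewrite inE.
case: ifPn => [Ji|_]; first by rewrite (negPf (JK _ Ji)) PT mule1.
by rewrite PT mul1e; case: ifP.
Qed.

Lemma measurable_coord_boxes (J : pred 'I_n) i k : J i ->
  measurable_fun [set: g_sigma_algebraType (boxes J)]
    ((fun w => x i w k 0) : g_sigma_algebraType (boxes J) -> R).
Proof.
move=> Ji _ A mA; rewrite setTI; apply: sub_sigma_algebra.
exists (fun j l => if (j == i) && (l == k) then A else setT).
  by move=> j l; case: ifP.
apply/seteqP; split => w.
  by move=> wA j _ l; case: ifP => [/andP[/eqP-> /eqP->]|_]; rewrite inE.
by move=> wB; have := wB i Ji k; rewrite !eqxx => /set_mem.
Qed.

Lemma expectM_boxes (J K : pred 'I_n) (f g : T -> R) :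
  (forall i, J i -> ~~ K i) ->
  measurable_fun [set: g_sigma_algebraType (boxes J)]
    (f : g_sigma_algebraType (boxes J) -> R) ->
  measurable_fun [set: g_sigma_algebraType (boxes K)]
    (g : g_sigma_algebraType (boxes K) -> R) ->
  finite_moments P f -> finite_moments P g ->
  expect P (fun w => f w * g w) = expect P f * expect P g.
Proof.
move=> JK mf mg fm gm; apply: expectM_indep => // A B mA mB.
have := mf measurableT A mA; have := mg measurableT B mB.
rewrite !setTI => gB fA.
apply: (indep_systems_sigma _ _ _ _ _ _ (indep_boxes JK)) => //.
all: try exact: boxes_measurable; try exact: boxes_setI; exact: boxes_setT.
Qed.

End VectorIndependence.

(** * Second and fourth moments of sums of independent centered variables *)

Section SumMoments.
Context (R : realType) (dT : measure_display) (T : measurableType dT).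
Variable P : probability T R.
Variables (n : nat) (Z : nat -> T -> R) (v u : R).
Local Notation E := (expect P).
Local Notation S m := (fun w => \sum_(i < m) Z i w).
Hypothesis Zm : forall i, finite_moments P (Z i).
Hypothesis Z1 : forall i, (i < n)%N -> E (Z i) = 0.
Hypothesis Z2 : forall i, (i < n)%N -> E (fun w => Z i w ^+ 2) <= v.
Hypothesis Z4 : forall i, (i < n)%N -> E (fun w => Z i w ^+ 4) <= u.
(** Independence enters only through the powers of a partial sum and of the next term, as the
    inductions on [m] consume it. *)
Hypothesis Zindep : forall m j l, (m < n)%N ->
  E (fun w => S m w ^+ j * Z m w ^+ l) = E (fun w => S m w ^+ j) * E (fun w => Z m w ^+ l).

Lemma finite_moments_partial m : finite_moments P (S m).
Proof. exact: finite_moments_sum. Qed.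

Lemma expect_partial1 m : (m <= n)%N -> E (S m) = 0.
Proof.
by move=> mn; rewrite expect_sum// big1// => i _; apply: Z1; exact: leq_trans mn.
Qed.

Lemma expect_partial2 m : (m <= n)%N -> E (fun w => S m w ^+ 2) <= m%:R * v.
Proof.
elim: m => [_|m IH mn].
  under [fun w => _]eq_fun do rewrite big_ord0 expr0n.
  by rewrite expect_cst mul0r.
have -> : E (fun w => S m.+1 w ^+ 2) = E (fun w => S m w ^+ 2) + E (fun w => Z m w ^+ 2).
  have SZ := finite_momentsM (finite_moments_partial m) (Zm m).
  have Sm2 := finite_momentsX 2 (finite_moments_partial m).
  have Zm2 := finite_momentsX 2 (Zm m).
  transitivity (E (fun w => (S m w ^+ 2 + 2 * (S m w * Z m w)) + Z m w ^+ 2)).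
    by congr (E _); apply/funext => w; rewrite big_ord_recr/=; ring.
  rewrite expectD//; last by apply: finite_momentsD => //; exact: finite_momentsZ.
  rewrite expectD//; last exact: finite_momentsZ.
  rewrite expectZ//; have := Zindep 1 1 mn; under [fun w => _]eq_fun do rewrite !expr1.
  move=> ->; under [fun w => Z m w ^+ 1]eq_fun do rewrite expr1.
  by rewrite Z1// mulr0 mulr0 addr0.
rewrite -natr1 mulrDl mul1r lerD ?Z2//; apply: IH; exact: ltnW.
Qed.

(** In the expansion of the fourth power the terms with a first power of the sum or of the new
    variable vanish. A step thus adds at most [6 * m%:R * v ^+ 2 + u], and [6 m] is at most
    [3 (m + 1)^2 - 3 m^2]. *)
Lemma expect_partial4 m : 0 <= v -> (m <= n)%N ->
  E (fun w => S m w ^+ 4) <= 3 * m%:R ^+ 2 * v ^+ 2 + m%:R * u.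
Proof.
move=> v0; elim: m => [_|m IH mn].
  under [fun w => _]eq_fun do rewrite big_ord0 expr0n.
  by rewrite expect_cst expr0n/= mulr0 !mul0r addr0.
pose F j l w := S m w ^+ j * Z m w ^+ l.
have Fm j l : finite_moments P (F j l).
  by apply: finite_momentsM; apply: finite_momentsX => //; exact: finite_moments_partial.
have -> : E (fun w => S m.+1 w ^+ 4) =
    E (F 4%N 0%N) + 4 * E (F 3%N 1%N) + 6 * E (F 2%N 2%N) + 4 * E (F 1%N 3%N) + E (F 0%N 4%N).
  transitivity (E (fun w => (F 4%N 0%N w + 4 * F 3%N 1%N w) + 6 * F 2%N 2%N w +
      4 * F 1%N 3%N w + F 0%N 4%N w)).
    by congr (E _); apply/funext => w; rewrite big_ord_recr/= /F; ring.
  have FZ c j l : finite_moments P (fun w => c * F j l w).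
    exact: finite_momentsZ.
  have m1 := finite_momentsD (Fm 4%N 0%N) (FZ 4 3%N 1%N).
  have m2 := finite_momentsD m1 (FZ 6 2%N 2%N).
  have m3 := finite_momentsD m2 (FZ 4 1%N 3%N).
  rewrite (expectD m3 (Fm 0%N 4%N)) (expectD m2 (FZ _ _ _)) (expectD m1 (FZ _ _ _)).
  by rewrite (expectD (Fm 4%N 0%N) (FZ _ _ _)) !(expectZ _ (Fm _ _)).
have E0 : E (fun w => Z m w ^+ 1) = 0 by under [fun w => _]eq_fun do rewrite expr1; exact: Z1.
have S0 : E (fun w => S m w ^+ 1) = 0.
  by under [fun w => _]eq_fun do rewrite expr1; apply: expect_partial1; exact: ltnW.
have FE j l : E (F j l) = E (fun w => S m w ^+ j) * E (fun w => Z m w ^+ l).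
  exact: Zindep.
rewrite !FE E0 S0 mulr0 mul0r mulr0 !addr0.
have -> : E (fun w => S m w ^+ 0) = 1.
  by under [fun w => _]eq_fun do rewrite expr0; rewrite expect_cst.
set s2 := E (fun w => S m w ^+ 2); set z2 := E (fun w => Z m w ^+ 2).
have s20 : 0 <= s2 by apply: Rintegral_ge0 => w _; exact: sqr_ge0.
have z20 : 0 <= z2 by apply: Rintegral_ge0 => w _; exact: sqr_ge0.
have sz : s2 * z2 <= m%:R * v * v.
  by apply: ler_pM => //; [exact/expect_partial2/ltnW|exact: Z2].
have := IH (ltnW mn); have := Z4 mn; have := sqr_ge0 v.
rewrite -natr1; nra.
Qed.

End SumMoments.

(** * Gaussian vectors and the sample covariance *)

(* [E X^8 <= gauss8 * (E X^2)^4] for a centered Gaussian [X]. *)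
Definition gauss8 (R : realType) : R := 2 * 4`!%:R * 3 ^+ 4.

Lemma gauss8_ge0 (R : realType) : 0 <= gauss8 R.
Proof. by rewrite /gauss8 !mulr_ge0// exprn_ge0. Qed.

Section GaussianForms.
Context (R : realType) (dT : measure_display) (T : measurableType dT).
Variable P : probability T R.
Local Notation E := (expect P).

Lemma ge0_integral_normal_law (X : T -> R) s (f : R -> \bar R) :
  measurable_fun [set: T] X ->
  (forall B, measurable B -> P [set w | X w \in B] = normal_prob 0 s B) ->
  measurable_fun [set: R] f -> (forall y, 0 <= f y)%E ->
  (\int[P]_w f (X w) = \int[normal_prob 0 s]_y f y)%E.
Proof.
move=> mX law mf f0; 
have mX' : @measurable_fun _ _ T (measurableTypeR R) [set: T] X.
  by move=> mT B mB; exact: mX.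
pose Y : {mfun T >-> measurableTypeR R} := @mfun_Sub _ _ T (measurableTypeR R) X (mem_set mX').
rewrite -[LHS](ge0_integral_distribution (P := P) Y mf f0).
apply: eq_measure_integral => A mA _; apply: etrans (law A mA).
rewrite /distribution /pushforward; congr (P _).
by apply/seteqP; split => w; [exact: mem_set|exact: set_mem].
Qed.

Lemma normal_law_moments (X : T -> R) s : s != 0 ->
  measurable_fun [set: T] X ->
  (forall B, measurable B -> P [set w | X w \in B] = normal_prob 0 s B) ->
  [/\ finite_moments P X, E (fun w => X w ^+ 2) = s ^+ 2 &
      E (fun w => X w ^+ 8) <= gauss8 R * s ^+ 8].
Proof.
move=> s0 mX law.
have XE k : (\int[P]_w (X w ^+ (2 * k))%:E =
    \int[normal_prob 0 s]_y (y ^+ (2 * k))%:E)%E.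
  apply: (@ge0_integral_normal_law X s (fun y => (y ^+ (2 * k))%:E)) => //.
  - by apply/measurable_EFinP; exact: measurable_funX.
  - by move=> y; rewrite lee_fin even_pow_ge0.
split.
- by split => // k; rewrite XE; exact: le_lt_trans (normal_moment_le k s0) (ltry _).
- by rewrite /expect /Rintegral (XE 1%N) normal_second_moment.
- rewrite /expect /Rintegral (XE 4%N); have := normal_moment_le 4 s0.
  have -> : 2 * 4`!%:R * (3 * s ^+ 2) ^+ 4 = gauss8 R * s ^+ 8.
    by rewrite /gauss8 exprMn -exprM mulrA.
  move=> H; rewrite -lee_fin fineK// ge0_fin_numE; first exact: le_lt_trans H (ltry _).
  by apply: integral_ge0 => y _; rewrite lee_fin even_pow_ge0.
Qed.

Variables (d : nat) (Sig : 'M[R]_d) (X : T -> 'cV[R]_d).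
Hypothesis Spd : pd_mx Sig.
Hypothesis Xg : gaussian_vec P X Sig.

Lemma gaussian_form (t : 'cV[R]_d) : t != 0 ->
  [/\ finite_moments P (fun w => (t^T *m X w) 0 0),
      E (fun w => (t^T *m X w) 0 0 ^+ 2) = (t^T *m Sig *m t) 0 0 &
      E (fun w => (t^T *m X w) 0 0 ^+ 8) <= gauss8 R * (t^T *m Sig *m t) 0 0 ^+ 4].
Proof.
move=> t0; have [_ /(_ t t0) q0] := Spd; have [mX /(_ t t0) law] := Xg.
set q := (t^T *m Sig *m t) 0 0 in q0 law *.
have mtX : measurable_fun [set: T] (fun w => (t^T *m X w) 0 0).
  under eq_fun do rewrite mxE.
  by apply: measurable_sum => k; exact: measurable_funM.
have s0 : Num.sqrt q != 0 by rewrite gt_eqF// sqrtr_gt0.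
have [? E2 E8] := normal_law_moments s0 mtX law.
split=> //; first by rewrite E2 sqr_sqrtr// ltW.
by apply: le_trans E8 _; rewrite -[8%N]/(2 * 4)%N exprM sqr_sqrtr// ltW.
Qed.

Lemma delta_form (a : 'I_d) (v : 'cV[R]_d) : ((delta_mx a 0 : 'cV[R]_d)^T *m v) 0 0 = v a 0.
Proof. by rewrite trmx_delta -rowE mxE. Qed.

Lemma delta_quad (a b : 'I_d) :
  ((delta_mx a 0 : 'cV[R]_d)^T *m Sig *m (delta_mx b 0 : 'cV[R]_d)) 0 0 = Sig a b.
Proof. by rewrite trmx_delta -rowE -colE !mxE. Qed.

Lemma gaussian_coord_moments a : finite_moments P (fun w => X w a 0) /\
  E (fun w => X w a 0 ^+ 8) <= gauss8 R * Sig a a ^+ 4.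
Proof.
have t0 : delta_mx a 0 != 0 :> 'cV[R]_d.
  by apply/eqP => /matrixP/(_ a 0); rewrite !mxE !eqxx => /eqP; rewrite oner_eq0.
have [m1 _ E8] := gaussian_form t0; rewrite delta_quad in E8.
under [fun w => X w a 0]eq_fun do rewrite -delta_form.
by under [fun w => X w a 0 ^+ 8]eq_fun do rewrite -delta_form.
Qed.

(** Polarization from the forms [X_a], [X_b] and [X_a + X_b]. The last one is nonzero also when
    [a = b], where it is twice a coordinate. *)
Lemma gaussian_covariance a b : E (fun w => X w a 0 * X w b 0) = Sig a b.
Proof.
have ST : Sig b a = Sig a b by case: Spd => /matrixP/(_ a b); rewrite mxE.
have sq c : finite_moments P (fun w => X w c 0 ^+ 2) /\
    E (fun w => X w c 0 ^+ 2) = Sig c c.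
  have t0 : delta_mx c 0 != 0 :> 'cV[R]_d.
    by apply/eqP => /matrixP/(_ c 0); rewrite !mxE !eqxx => /eqP; rewrite oner_eq0.
  have [m1 E2 _] := gaussian_form t0; rewrite delta_quad in E2; split.
    exact: finite_momentsX (gaussian_coord_moments c).1.
  by under eq_fun do rewrite -delta_form.
pose t : 'cV[R]_d := delta_mx a 0 + delta_mx b 0.
have t0 : t != 0.
  apply/eqP => /matrixP/(_ a 0); rewrite !mxE !eqxx/=.
  by case: (a == b) => /eqP; rewrite ?addr0 ?oner_eq0// -[_ == 0]/(2%:R == 0) pnatr_eq0.
have [m2 E2 _] := gaussian_form t0.
have tX w : (t^T *m X w) 0 0 = X w a 0 + X w b 0.
  by rewrite [t^T]linearD/= mulmxDl mxE !delta_form.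
have tS : (t^T *m Sig *m t) 0 0 = Sig a a + Sig b b + 2 * Sig a b.
  rewrite [t^T]linearD/= !mulmxDl !mulmxDr.
  by rewrite mxE [X in X + _]mxE [X in _ + X]mxE !delta_quad ST; ring.
have [ma Ea] := sq a; have [mb Eb] := sq b.
have mt := finite_momentsX 2 m2.
transitivity (E (fun w => 2^-1 * ((t^T *m X w) 0 0 ^+ 2 - X w a 0 ^+ 2 - X w b 0 ^+ 2))).
  by congr (E _); apply/funext => w; rewrite tX; field.
rewrite expectZ; last by do 2 apply: finite_momentsB => //.
rewrite expectB//; last exact: finite_momentsB.
by rewrite expectB// E2 tS Ea Eb; field.
Qed.

End GaussianForms.

Section SampleCovariance.
Context (R : realType) (dT : measure_display) (T : measurableType dT).
Variable P : probability T R.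
Local Notation E := (expect P).
Variables (d n : nat) (Sig : 'M[R]_d) (x : 'I_n.+1 -> T -> 'cV[R]_d) (M : R).
Hypothesis Spd : pd_mx Sig.
Hypothesis xg : forall i, gaussian_vec P (x i) Sig.
Hypothesis ix : indep_vecs P x.
Hypothesis M1 : 1 <= M.
Hypothesis SM : forall a b, `|Sig a b| <= M.
Variables a b : 'I_d.

(** Indexed by all natural numbers to fit the partial sums above; [inord] supplies a default sample
    beyond the range. *)
Let Z (i : nat) w : R := x (inord i) w a 0 * x (inord i) w b 0 - Sig a b.
Let S m w : R := \sum_(i < m) Z i w.

Let mx i k : measurable_fun [set: T] (fun w => x i w k 0).
Proof. by have [+ _] := xg i; apply. Qed.

Let Zm i : finite_moments P (Z i).
Proof.
apply: finite_momentsB; last exact: finite_moments_cst.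
by apply: finite_momentsM; exact: (gaussian_coord_moments Spd (xg _) _).1.
Qed.

Let Z1 i : E (Z i) = 0.
Proof.
rewrite expectB; last exact: finite_moments_cst.
  by rewrite expect_cst (gaussian_covariance Spd (xg _)) subrr.
by apply: finite_momentsM; exact: (gaussian_coord_moments Spd (xg _) _).1.
Qed.

(** From [(y - z)^4 <= 8 (y^4 + z^4)] and [2 p^4 q^4 <= p^8 + q^8]; it reduces the fourth moment of
    a centered product to eighth moments of single coordinates. *)
Lemma pow4_sub_le (p q r : R) :
  (p * q - r) ^+ 4 <= 4 * (p ^+ 8 + q ^+ 8) + 8 * r ^+ 4.
Proof.
have sq (y z : R) : (y - z) ^+ 4 <= 8 * (y ^+ 4 + z ^+ 4).
  have h1 : 0 <= (y - z) ^+ 2 by exact: sqr_ge0.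
  have h2 : (y - z) ^+ 2 <= 2 * (y ^+ 2 + z ^+ 2).
    by have := sqr_ge0 (y + z); nra.
  have h3 := sqr_ge0 (y ^+ 2 - z ^+ 2).
  have -> : (y - z) ^+ 4 = (y - z) ^+ 2 * (y - z) ^+ 2 by ring.
  apply: le_trans (ler_pM h1 h1 h2 h2) _; nra.
apply: le_trans (sq _ _) _.
by have := sqr_ge0 (p ^+ 4 - q ^+ 4); nra.
Qed.

Let Z4 i : E (fun w => Z i w ^+ 4) <= (8 * (gauss8 R + 1)) * M ^+ 4.
Proof.
have [xa Ea] := gaussian_coord_moments Spd (xg (inord i)) a.
have [xb Eb] := gaussian_coord_moments Spd (xg (inord i)) b.
have ma := finite_momentsX 8 xa; have mb := finite_momentsX 8 xb.
have ms := finite_momentsZ 4 (finite_momentsD ma mb).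
have mc := finite_moments_cst P (8 * Sig a b ^+ 4).
apply: le_trans (expect_le (finite_momentsX 4 (Zm i)) (finite_momentsD ms mc)
  (fun w => pow4_sub_le _ _ _)) _.
rewrite (expectD ms mc) expect_cst (expectZ _ (finite_momentsD ma mb)) (expectD ma mb).
have S4 c e : Sig c e ^+ 4 <= M ^+ 4.
  rewrite -(@ger0_norm _ (Sig c e ^+ 4)) ?exprn_even_ge0// normrX.
  by rewrite lerXn2r ?nnegrE ?normr_ge0 ?SM ?(le_trans _ M1).
have := gauss8_ge0 R; move: (gauss8 R) Ea Eb => c Ea Eb c0.
have := ler_wpM2l c0 (S4 a a); have := ler_wpM2l c0 (S4 b b).
by have := S4 a b; lra.
Qed.

Let Z2 i : E (fun w => Z i w ^+ 2) <= (8 * gauss8 R + 9) * M ^+ 4.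
Proof.
have m4 := finite_momentsX 4 (Zm i).
have mc := finite_moments_cst P (1 : R).
(* The second moment is read off the fourth; the extra [1], at most [M ^+ 4], turns the constant [8]
   into [9]. *)
apply: (@le_trans _ _ (E (fun w => 1 + Z i w ^+ 4))).
  apply: expect_le; [exact: finite_momentsX|exact: finite_momentsD|move=> w].
  by have := sqr_ge0 (Z i w ^+ 2 - 1); have := sqr_ge0 (Z i w); nra.
rewrite (expectD mc m4) expect_cst.
have M4 : 1 <= M ^+ 4 by rewrite exprn_ege1.
by have := Z4 i; have := gauss8_ge0 R; lra.
Qed.

Let Zindep m j l : (m < n.+1)%N ->
  E (fun w => S m w ^+ j * Z m w ^+ l) = E (fun w => S m w ^+ j) * E (fun w => Z m w ^+ l).
Proof.
(* The partial sum depends on the samples below [m], the next term on sample [m] alone. *)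
move=> mn; pose J : pred 'I_n.+1 := [pred i : 'I_n.+1 | (i < m)%N].
pose K : pred 'I_n.+1 := pred1 (inord m).
have mZ (L : pred 'I_n.+1) i : L (inord i) ->
    measurable_fun [set: g_sigma_algebraType (boxes x L)]
      (Z i : g_sigma_algebraType (boxes x L) -> R).
  move=> Li; apply: measurable_funB => //.
  by apply: measurable_funM; exact: measurable_coord_boxes.
apply: (@expectM_boxes _ _ _ P _ _ x mx ix J K).
- move=> i im; apply/negP => /eqP/(congr1 (@nat_of_ord _)) iE; move: im.
  by rewrite /J/= iE inordK// ltnn.
- apply: measurable_funX; apply: measurable_sum => i.
  by apply: mZ; rewrite /J/= inordK//; exact: ltn_trans (ltn_ord i) mn.
- by apply: measurable_funX; apply: mZ; rewrite /K/= eqxx.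
- exact/finite_momentsX/finite_moments_sum.
- exact: finite_momentsX.
Qed.

Let dev w : R := sample_cov (fun i => x i w) a b - Sig a b.

Let devE w : dev w = n.+1%:R^-1 * S n.+1 w.
Proof.
rewrite /dev /sample_cov !mxE /S summxE.
rewrite [in RHS](eq_bigr (fun i : 'I_n.+1 => (x i w *m (x i w)^T) a b - Sig a b)).
  rewrite sumrB sumr_const card_ord mulrBr -[Sig a b *+ _]mulr_natl mulKf//.
by move=> i _; rewrite /Z inord_val mxE big_ord1 mxE.
Qed.

(** With [v = (8 * gauss8 R + 9) * M ^+ 4 >= 1], the variance is at most [v / n.+1%:R]. The fourth
    moment is of order [n^-2], but is relaxed to [4 * v ^+ 2 / n.+1%:R] so that one constant
    [K = 5 * v ^+ 2] serves both. *)
Lemma sample_cov_deviation (K := 5 * ((8 * gauss8 R + 9) * M ^+ 4) ^+ 2) :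
  [/\ finite_moments P dev, E dev = 0,
      E (fun w => dev w ^+ 2) <= K / n.+1%:R &
      E (fun w => dev w ^+ 4) <= K / n.+1%:R].
Proof.
have SmE : finite_moments P (S n.+1) by exact: finite_moments_sum.
have -> : dev = fun w => n.+1%:R^-1 * S n.+1 w by apply/funext => w; exact: devE.
set N : R := n.+1%:R.
have N1 : 1 <= N by rewrite ler1n.
have NV1 : N^-1 <= 1 by rewrite invf_le1//; lra.
have NV0 : 0 < N^-1 by rewrite invr_gt0; lra.
have NN : N^-1 * N = 1 by rewrite mulVf//; lra.
set v := (8 * gauss8 R + 9) * M ^+ 4 in K *.
have M4 : 1 <= M ^+ 4 by rewrite exprn_ege1.
have c0 := gauss8_ge0 R.
have v1 : 1 <= v by rewrite /v; nra.
have E2 := expect_partial2 Zm (fun i _ => Z1 i) (fun i _ => Z2 i) Zindep (leqnn _).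
have E4 := expect_partial4 Zm (fun i _ => Z1 i) (fun i _ => Z2 i) (fun i _ => Z4 i)
  Zindep (le_trans ler01 v1) (leqnn _).
split.
- exact: finite_momentsZ.
- by rewrite expectZ// (expect_partial1 Zm (n := n.+1) (fun i _ => Z1 i))// mulr0.
- under eq_fun do rewrite exprMn; rewrite expectZ; last exact: finite_momentsX.
  apply: (@le_trans _ _ (N^-1 ^+ 2 * (N * v))).
    by rewrite ler_wpM2l// sqr_ge0.
  have -> : N^-1 ^+ 2 * (N * v) = v * N^-1 * (N^-1 * N) by ring.
  by rewrite NN mulr1 ler_wpM2r ?(ltW NV0)// /K -/v; nra.
- under eq_fun do rewrite exprMn; rewrite expectZ; last exact: finite_momentsX.
  apply: (@le_trans _ _ (N^-1 ^+ 4 * (3 * N ^+ 2 * v ^+ 2 + N * ((8 * (gauss8 R + 1)) * M ^+ 4)))).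
    by rewrite ler_wpM2l// exprn_ge0// ltW.
  have -> : N^-1 ^+ 4 * (3 * N ^+ 2 * v ^+ 2 + N * ((8 * (gauss8 R + 1)) * M ^+ 4)) =
    3 * v ^+ 2 * N^-1 ^+ 2 * (N^-1 * N) ^+ 2 + ((8 * (gauss8 R + 1)) * M ^+ 4) * N^-1 ^+ 3 * (N^-1 * N) by ring.
  rewrite NN expr1n !mulr1.
  have i2 : N^-1 ^+ 2 <= N^-1 by rewrite expr2; apply: ler_piMl => //; exact: ltW.
  have i3 : N^-1 ^+ 3 <= N^-1.
    apply: le_trans i2; rewrite exprS; apply: ler_piMl => //; exact: sqr_ge0.
  have uv : 8 * (gauss8 R + 1) * M ^+ 4 <= v ^+ 2.
    have uv1 : 8 * (gauss8 R + 1) * M ^+ 4 <= v by rewrite /v; lra.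
    by apply: le_trans uv1 _; nra.
  have u0 : 0 <= 8 * (gauss8 R + 1) * M ^+ 4 by nra.
  apply: (@le_trans _ _ (3 * v ^+ 2 * N^-1 + v ^+ 2 * N^-1)).
    apply: lerD; first by rewrite ler_wpM2l// mulr_ge0// sqr_ge0.
    by apply: ler_pM => //; rewrite exprn_ge0// ltW.
  by rewrite /K -mulrDl ler_wpM2r ?(ltW NV0)//; have := sqr_ge0 v; lra.
Qed.

End SampleCovariance.

(** * Bias of products of four random matrices *)

Section Bias.
Context (R : realType) (dT : measure_display) (T : measurableType dT).
Variable P : probability T R.
Local Notation E := (expect P).

Definition bias_le (f : T -> R) (f0 K : R) :=
  finite_moments P f /\ `|E f - f0| <= K.

Lemma bias_leB f f0 K g g0 L : bias_le f f0 K -> bias_le g g0 L ->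
  bias_le (fun w => f w - g w) (f0 - g0) (K + L).
Proof.
move=> [fm fK] [gm gL]; split; first exact: finite_momentsB.
rewrite expectB// (_ : _ - _ = (E f - f0) - (E g - g0)); last by ring.
exact: le_trans (ler_normB _ _) (lerD fK gL).
Qed.

Lemma bias_leZ c f f0 K : bias_le f f0 K ->
  bias_le (fun w => c * f w) (c * f0) (`|c| * K).
Proof.
move=> [fm fK]; split; first exact: finite_momentsZ.
by rewrite expectZ// -mulrBr normrM ler_wpM2l.
Qed.

Lemma bias_le_sum d (F : 'I_d -> T -> R) (F0 : 'I_d -> R) K :
  (forall i, bias_le (F i) (F0 i) K) ->
  bias_le (fun w => \sum_i F i w) (\sum_i F0 i) (d%:R * K).
Proof.
move=> FK; split; first by apply: finite_moments_sum => i; exact: (FK i).1.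
rewrite expect_sum; last by move=> i; exact: (FK i).1.
rewrite -sumrB (le_trans (ler_norm_sum _ _ _))//.
rewrite (le_trans (ler_sum _ (fun i _ => (FK i).2)))//.
by rewrite sumr_const card_ord mulr_natl.
Qed.

(** The scalar [p] holds the entries already picked while a long matrix product is expanded from the
    left, one summation at a time. *)
Lemma bias_le_mulmx m d q (p : T -> R) p0 (A : T -> 'M[R]_(m, d)) (A0 : 'M[R]_(m, d))
    (B : T -> 'M[R]_(d, q)) (B0 : 'M[R]_(d, q)) i j K :
  (forall k, bias_le (fun w => p w * A w i k * B w k j) (p0 * A0 i k * B0 k j) K) ->
  bias_le (fun w => p w * (A w *m B w) i j) (p0 * (A0 *m B0) i j) (d%:R * K).
Proof.
move=> H; have := bias_le_sum H; rewrite mxE mulr_sumr.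
under [\sum_k (p0 * _)]eq_bigr do rewrite mulrA.
suff -> : (fun w => p w * (A w *m B w) i j) =
  (fun w => \sum_k (p w * A w i k * B w k j)) by [].
by apply/funext => w; rewrite mxE mulr_sumr; apply: eq_bigr => k _; rewrite mulrA.
Qed.

Lemma bias_le_cst_mulmx m d q (p : T -> R) p0 (C : 'M[R]_(m, d))
    (B : T -> 'M[R]_(d, q)) (B0 : 'M[R]_(d, q)) i j K w0 :
  (forall k, bias_le (fun w => p w * B w k j) (p0 * B0 k j) K) ->
  (forall k, `|C i k| <= w0) ->
  bias_le (fun w => p w * (C *m B w) i j) (p0 * (C *m B0) i j) (d%:R * (w0 * K)).
Proof.
move=> H Cw; apply: bias_le_mulmx => k.
have [Hm HK] := bias_leZ (C i k) (H k).
suff [-> ->] : (fun w => p w * C i k * B w k j) =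
    (fun w => C i k * (p w * B w k j)) /\
    p0 * C i k * B0 k j = C i k * (p0 * B0 k j).
  split=> //; apply: le_trans HK _; rewrite ler_wpM2r ?Cw//.
  exact: le_trans (normr_ge0 _) (H k).2.
by split; [apply/funext => w|]; ring.
Qed.

Definition centered_dev (f : T -> R) (f0 v : R) :=
  [/\ finite_moments P (fun w => f w - f0), E (fun w => f w - f0) = 0,
      E (fun w => (f w - f0) ^+ 2) <= v & E (fun w => (f w - f0) ^+ 4) <= v].

(** Lets identity matrices occupy random places, so that products with fewer than four random
    factors need no separate treatment. *)
Lemma centered_dev_cst (c v : R) : 0 <= v -> centered_dev (fun=> c) c v.
Proof.
move=> v0; split; first exact: finite_moments_cst.
all: by rewrite expect_cst subrr ?expr0n.
Qed.

(** Six quadratic, four cubic and one quartic term remain, each at most [M ^+ 2 * q]: this is the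
    [11]. A cubic term [y z t] is split as [(y z)^2 + t^2 <= y^4 + z^4 + t^2], so no odd absolute
    moment appears. *)
Lemma prod4_remainder (M q s1 s2 s3 s4 a b c e : R) : 1 <= M ->
  `|s1| <= M -> `|s2| <= M -> `|s3| <= M -> `|s4| <= M ->
  q = (a ^+ 2 + a ^+ 4) + (b ^+ 2 + b ^+ 4) + (c ^+ 2 + c ^+ 4) + (e ^+ 2 + e ^+ 4) ->
  `|(s1 + a) * (s2 + b) * (s3 + c) * (s4 + e) - s1 * s2 * s3 * s4 -
    (s2 * s3 * s4 * a + s1 * s3 * s4 * b + s1 * s2 * s4 * c + s1 * s2 * s3 * e)|
  <= 11 * M ^+ 2 * q.
Proof.
move=> M1 h1 h2 h3 h4 qE.
have M0 : 0 <= M by exact: le_trans M1.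
have p2 (y : R) : 0 <= y ^+ 2 by exact: sqr_ge0.
have p4 (y : R) : 0 <= y ^+ 4 by exact: exprn_even_ge0.
have q0 : 0 <= q by rewrite qE !addr_ge0.
have n2 (y z : R) : `|y * z| <= y ^+ 2 + z ^+ 2.
  rewrite ler_norml; apply/andP; split.
    by have := p2 (y + z); have := p2 y; have := p2 z; nra.
  by have := p2 (y - z); have := p2 y; have := p2 z; nra.
have n22 (y z : R) : (y * z) ^+ 2 <= y ^+ 4 + z ^+ 4.
  by have := p2 (y ^+ 2 - z ^+ 2); have := p4 y; have := p4 z; nra.
have n3 (y z t : R) : `|y * z * t| <= y ^+ 4 + z ^+ 4 + t ^+ 2.
  by apply: le_trans (n2 _ _) _; rewrite lerD2r.
have n4 : `|a * b * (c * e)| <= a ^+ 4 + b ^+ 4 + (c ^+ 4 + e ^+ 4).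
  by apply: le_trans (n2 _ _) _; rewrite lerD.
have M2 : 1 <= M ^+ 2 by rewrite exprn_ege1.
have MM : M <= M ^+ 2 by rewrite expr2 ler_peMr.
have bnd (k t : R) : `|k| <= M ^+ 2 -> `|t| <= q -> `|k * t| <= M ^+ 2 * q.
  by move=> kM tq; rewrite normrM ler_pM.
have c2 (y z : R) : `|y| <= M -> `|z| <= M -> `|y * z| <= M ^+ 2.
  by move=> yM zM; rewrite normrM expr2 ler_pM.
have c1 (y : R) : `|y| <= M -> `|y| <= M ^+ 2 by move=> /le_trans; apply.
have [[[a2 b2] d2] e2] := (p2 a, p2 b, p2 c, p2 e).
have [[[a4 b4] d4] e4] := (p4 a, p4 b, p4 c, p4 e).
have t1 : `|s3 * s4 * (a * b)| <= M ^+ 2 * q.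
  by apply: bnd (c2 _ _ _ _) (le_trans (n2 _ _) _) => //; rewrite qE; lra.
have t2 : `|s2 * s4 * (a * c)| <= M ^+ 2 * q.
  by apply: bnd (c2 _ _ _ _) (le_trans (n2 _ _) _) => //; rewrite qE; lra.
have t3 : `|s2 * s3 * (a * e)| <= M ^+ 2 * q.
  by apply: bnd (c2 _ _ _ _) (le_trans (n2 _ _) _) => //; rewrite qE; lra.
have t4 : `|s1 * s4 * (b * c)| <= M ^+ 2 * q.
  by apply: bnd (c2 _ _ _ _) (le_trans (n2 _ _) _) => //; rewrite qE; lra.
have t5 : `|s1 * s3 * (b * e)| <= M ^+ 2 * q.
  by apply: bnd (c2 _ _ _ _) (le_trans (n2 _ _) _) => //; rewrite qE; lra.
have t6 : `|s1 * s2 * (c * e)| <= M ^+ 2 * q.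
  by apply: bnd (c2 _ _ _ _) (le_trans (n2 _ _) _) => //; rewrite qE; lra.
have t7 : `|s4 * (a * b * c)| <= M ^+ 2 * q.
  by apply: bnd (c1 _ _) (le_trans (n3 _ _ _) _) => //; rewrite qE; lra.
have t8 : `|s3 * (a * b * e)| <= M ^+ 2 * q.
  by apply: bnd (c1 _ _) (le_trans (n3 _ _ _) _) => //; rewrite qE; lra.
have t9 : `|s2 * (a * c * e)| <= M ^+ 2 * q.
  by apply: bnd (c1 _ _) (le_trans (n3 _ _ _) _) => //; rewrite qE; lra.
have t10 : `|s1 * (b * c * e)| <= M ^+ 2 * q.
  by apply: bnd (c1 _ _) (le_trans (n3 _ _ _) _) => //; rewrite qE; lra.
have t11 : `|1 * (a * b * (c * e))| <= M ^+ 2 * q.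
  by apply: bnd; rewrite ?normr1//; apply: le_trans n4 _; rewrite qE; lra.
rewrite (_ : _ - _ - _ = s3 * s4 * (a * b) + s2 * s4 * (a * c) + s2 * s3 * (a * e) +
  s1 * s4 * (b * c) + s1 * s3 * (b * e) + s1 * s2 * (c * e) + s4 * (a * b * c) +
  s3 * (a * b * e) + s2 * (a * c * e) + s1 * (b * c * e) + 1 * (a * b * (c * e)));
  last by ring.
rewrite (_ : 11 * M ^+ 2 * q = M ^+ 2 * q + M ^+ 2 * q + M ^+ 2 * q + M ^+ 2 * q +
  M ^+ 2 * q + M ^+ 2 * q + M ^+ 2 * q + M ^+ 2 * q + M ^+ 2 * q + M ^+ 2 * q +
  M ^+ 2 * q); last by ring.
by do 10 (apply: le_trans (ler_normD _ _) _; apply: lerD => //).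
Qed.

Lemma bias_le_prod4 (f1 f2 f3 f4 : T -> R) (s1 s2 s3 s4 M v : R) : 1 <= M ->
  `|s1| <= M -> `|s2| <= M -> `|s3| <= M -> `|s4| <= M ->
  centered_dev f1 s1 v -> centered_dev f2 s2 v ->
  centered_dev f3 s3 v -> centered_dev f4 s4 v ->
  bias_le (fun w => f1 w * f2 w * f3 w * f4 w) (s1 * s2 * s3 * s4)
    (88 * M ^+ 2 * v).
Proof.
move=> M1 h1 h2 h3 h4 [a0 a1 a2 a4] [b0 b1 b2 b4] [c0 c1 c2 c4] [e0 e1 e2 e4].
have fm f s : finite_moments P (fun w => f w - s) -> finite_moments P f.
  move=> /finite_momentsD/(_ (finite_moments_cst P s)).
  by under eq_fun do rewrite subrK.
pose q w := ((f1 w - s1) ^+ 2 + (f1 w - s1) ^+ 4) + ((f2 w - s2) ^+ 2 + (f2 w - s2) ^+ 4)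
  + ((f3 w - s3) ^+ 2 + (f3 w - s3) ^+ 4) + ((f4 w - s4) ^+ 2 + (f4 w - s4) ^+ 4).
pose L w := s2 * s3 * s4 * (f1 w - s1) + s1 * s3 * s4 * (f2 w - s2)
  + s1 * s2 * s4 * (f3 w - s3) + s1 * s2 * s3 * (f4 w - s4).
have Xm (g : T -> R) : finite_moments P g ->
    finite_moments P (fun w => g w ^+ 2 + g w ^+ 4).
  by move=> gm; apply: finite_momentsD; exact: finite_momentsX.
have XE (g : T -> R) : finite_moments P g -> E (fun w => g w ^+ 2) <= v ->
    E (fun w => g w ^+ 4) <= v -> E (fun w => g w ^+ 2 + g w ^+ 4) <= 2 * v.
  by move=> gm g2 g4; rewrite expectD; [lra|exact: finite_momentsX..].
have q3 := finite_momentsD (Xm _ a0) (Xm _ b0).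
have q2 := finite_momentsD q3 (Xm _ c0).
have qm : finite_moments P q := finite_momentsD q2 (Xm _ e0).
(* Eight moments of at most [v] each; times the [11] terms of the remainder, this is the [88]. *)
have qv : E q <= 8 * v.
  rewrite (expectD q2 (Xm _ e0)) (expectD q3 (Xm _ c0)) (expectD (Xm _ a0) (Xm _ b0)).
  have := XE _ a0 a2 a4; have := XE _ b0 b2 b4.
  by have := XE _ c0 c2 c4; have := XE _ e0 e2 e4; lra.
have L1 := finite_momentsZ (s2 * s3 * s4) a0.
have L2 := finite_momentsZ (s1 * s3 * s4) b0.
have L3 := finite_momentsZ (s1 * s2 * s4) c0.
have L4 := finite_momentsZ (s1 * s2 * s3) e0.
have L12 := finite_momentsD L1 L2.
have L123 := finite_momentsD L12 L3.
have Lm : finite_moments P L := finite_momentsD L123 L4.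
have LE : E L = 0.
  rewrite (expectD L123 L4) (expectD L12 L3) (expectD L1 L2).
  by rewrite (expectZ _ a0) (expectZ _ b0) (expectZ _ c0) (expectZ _ e0) a1 b1 c1 e1 !mulr0 !addr0.
have Fm : finite_moments P (fun w => f1 w * f2 w * f3 w * f4 w).
  exact: finite_momentsM (finite_momentsM (finite_momentsM (fm _ _ a0)
    (fm _ _ b0)) (fm _ _ c0)) (fm _ _ e0).
split => //.
have sm := finite_moments_cst P (s1 * s2 * s3 * s4).
have -> : E (fun w => f1 w * f2 w * f3 w * f4 w) - s1 * s2 * s3 * s4 =
    E (fun w => f1 w * f2 w * f3 w * f4 w - s1 * s2 * s3 * s4 - L w).
  rewrite (expectB (finite_momentsB Fm sm) Lm) LE subr0.
  by rewrite (expectB Fm sm) expect_cst.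
apply: le_trans (expect_norm_le (finite_momentsB (finite_momentsB Fm sm) Lm)
  (finite_momentsZ (11 * M ^+ 2) qm) _) _.
  move=> w; have := @prod4_remainder M (q w) s1 s2 s3 s4 (f1 w - s1) (f2 w - s2)
    (f3 w - s3) (f4 w - s4) M1 h1 h2 h3 h4 erefl.
  by rewrite ![_ + (_ - _)]addrC !subrK.
rewrite expectZ// (_ : 88 * M ^+ 2 * v = 11 * M ^+ 2 * (8 * v)); last by ring.
by rewrite ler_wpM2l// mulr_ge0// sqr_ge0.
Qed.

(** Every term of both gradients fits this alternating pattern. The seven summations give
    [d%:R ^+ 7], the four constant matrices [M ^+ 4]. *)
Lemma bias_le_product m d (W : 'M[R]_(m, d)) (X Y Z : 'M[R]_d)
    (S1 S2 S3 S4 : T -> 'M[R]_d) (T1 T2 T3 T4 : 'M[R]_d) (M v : R) i j : 1 <= M ->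
  (forall i k, `|W i k| <= M) -> (forall i k, `|X i k| <= M) ->
  (forall i k, `|Y i k| <= M) -> (forall i k, `|Z i k| <= M) ->
  (forall i k, `|T1 i k| <= M) -> (forall i k, `|T2 i k| <= M) ->
  (forall i k, `|T3 i k| <= M) -> (forall i k, `|T4 i k| <= M) ->
  (forall i k, centered_dev (fun w => S1 w i k) (T1 i k) v) ->
  (forall i k, centered_dev (fun w => S2 w i k) (T2 i k) v) ->
  (forall i k, centered_dev (fun w => S3 w i k) (T3 i k) v) ->
  (forall i k, centered_dev (fun w => S4 w i k) (T4 i k) v) ->
  bias_le
    (fun w => (W *m (S1 w *m (X *m (S2 w *m (Y *m (S3 w *m (Z *m S4 w))))))) i j)
    ((W *m (T1 *m (X *m (T2 *m (Y *m (T3 *m (Z *m T4))))))) i j)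
    (d%:R ^+ 7 * M ^+ 4 * (88 * M ^+ 2 * v)).
Proof.
move=> M1 hW hX hY hZ h1 h2 h3 h4 d1 d2 d3 d4.
have [Hm HK] : bias_le
    (fun w => 1 * (W *m (S1 w *m (X *m (S2 w *m (Y *m (S3 w *m (Z *m S4 w))))))) i j)
    (1 * (W *m (T1 *m (X *m (T2 *m (Y *m (T3 *m (Z *m T4))))))) i j)
    (d%:R * (M * (d%:R * (d%:R * (M * (d%:R * (d%:R * (M * (d%:R * (d%:R * (M * (88 * M ^+ 2 * v)))))))))))).
  apply: bias_le_cst_mulmx => // k1; apply: bias_le_mulmx => k2.
  apply: bias_le_cst_mulmx => // k3; apply: bias_le_mulmx => k4.
  apply: bias_le_cst_mulmx => // k5; apply: bias_le_mulmx => k6.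
  apply: bias_le_cst_mulmx => // k7.
  have := bias_le_prod4 M1 (h1 k1 k2) (h2 k3 k4) (h3 k5 k6) (h4 k7 j)
    (d1 k1 k2) (d2 k3 k4) (d3 k5 k6) (d4 k7 j).
  by under [fun w => 1 * _ * _ * _ * _]eq_fun do rewrite mul1r; rewrite mul1r.
rewrite mul1r in HK.
have eqf : (fun w => 1 * (W *m (S1 w *m (X *m (S2 w *m (Y *m (S3 w *m (Z *m S4 w))))))) i j)
  = fun w => (W *m (S1 w *m (X *m (S2 w *m (Y *m (S3 w *m (Z *m S4 w))))))) i j.
  by apply/funext => w; rewrite mul1r.
rewrite eqf in Hm HK; split => //; apply: le_trans HK _.
by rewrite le_eqVlt; apply/orP; left; apply/eqP; ring.
Qed.

End Bias.

(** * Positivity of covariances and bounds on matrix entries *)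

Lemma pd_psd (R : realType) d (S : 'M[R]_d) : pd_mx S -> psd_mx S.
Proof.
move=> [ST S0]; split => // v; have [->|/S0/ltW//] := eqVneq v 0.
by rewrite mulmx0 mxE.
Qed.

Lemma sample_cov_psd (R : realType) d n (x : 'I_n -> 'cV[R]_d) :
  psd_mx (sample_cov x).
Proof.
split=> [|v].
  rewrite /sample_cov linearZ/= linear_sum/=; congr (_ *: _).
  by apply: eq_bigr => i _; rewrite trmx_mul trmxK.
rewrite /sample_cov -scalemxAr -scalemxAl mxE mulr_ge0 ?invr_ge0//.
rewrite mulmx_sumr mulmx_suml summxE sumr_ge0// => i _.
rewrite mulmxA -[_ *m (x i)^T *m v]mulmxA.
have -> : v^T *m x i = ((x i)^T *m v)^T by rewrite trmx_mul trmxK.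
exact: mul_trmx_cV_ge0.
Qed.

Section EntryBounds.
Variable R : realType.

Lemma sqr_le_frob2 m n (A : 'M[R]_(m, n)) i j : A i j ^+ 2 <= frob2 A.
Proof.
rewrite /frob2 (bigD1 i)//= (bigD1 j)//= -addrA lerDl addr_ge0//.
  by apply: sumr_ge0 => k _; exact: sqr_ge0.
by apply: sumr_ge0 => k _; apply: sumr_ge0 => l _; exact: sqr_ge0.
Qed.

Lemma frob2_ge0 m n (A : 'M[R]_(m, n)) : 0 <= frob2 A.
Proof. by apply: sumr_ge0 => i _; apply: sumr_ge0 => j _; exact: sqr_ge0. Qed.

Lemma norm_entry_le m n (A : 'M[R]_(m, n)) i j : `|A i j| <= 1 + frob2 A.
Proof.
have := sqr_le_frob2 A i j; rewrite -real_normK ?num_real//.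
by have := sqr_ge0 (`|A i j| - 1); nra.
Qed.

Lemma frob2_tr m n (A : 'M[R]_(m, n)) : frob2 A^T = frob2 A.
Proof.
rewrite /frob2 exchange_big; apply: eq_bigr => i _; apply: eq_bigr => j _.
by rewrite mxE.
Qed.

(** [A^T *m A] is treated as a single constant factor; a bound linear in [frob2 A] keeps it below
    the same [M] as the other matrices. *)
Lemma norm_gram_entry_le m n (A : 'M[R]_(m, n)) i j :
  `|(A^T *m A) i j| <= frob2 A.
Proof.
have col k : \sum_l A l k ^+ 2 <= frob2 A.
  rewrite -frob2_tr /frob2 (bigD1 k)//=.
  rewrite (eq_bigr (fun l => A^T k l ^+ 2)) => [|l _]; last by rewrite mxE.
  by rewrite lerDl; apply: sumr_ge0 => p _; apply: sumr_ge0 => l _; exact: sqr_ge0.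
rewrite mxE (le_trans (ler_norm_sum _ _ _))//.
apply: (@le_trans _ _ (\sum_l (2^-1 * A l i ^+ 2 + 2^-1 * A l j ^+ 2))).
  apply: ler_sum => l _; rewrite mxE ler_norml; apply/andP; split.
    by have := sqr_ge0 (A l i + A l j); nra.
  by have := sqr_ge0 (A l i - A l j); nra.
rewrite big_split/= -!mulr_sumr; have := col i; have := col j; lra.
Qed.

Lemma frob2_le m n (A : 'M[R]_(m, n)) K : (forall i j, `|A i j| <= K) ->
  frob2 A <= m%:R * n%:R * K ^+ 2.
Proof.
move=> AK; apply: (@le_trans _ _ (\sum_(i < m) \sum_(j < n) K ^+ 2)).
  apply: ler_sum => i _; apply: ler_sum => j _; have := AK i j.
  rewrite -(real_normK (num_real (A i j))) => AKij.
  by rewrite lerXn2r// nnegrE// (le_trans _ AKij).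
by rewrite !sumr_const !card_ord -[_ *+ m]mulr_natl -[_ *+ n]mulr_natl mulrA.
Qed.

End EntryBounds.

Lemma Emx_expect (R : realType) (dT : measure_display) (T : measurableType dT)
    (P : probability T R) m k (X : T -> 'M[R]_(m, k)) i j :
  Emx P X i j = expect P (fun w => X w i j).
Proof. by rewrite mxE unlock. Qed.

(** * Bias of the entries of the gradient *)

Section GradientBias.
Context (R : realType) (dT : measure_display) (T : measurableType dT).
Variable P : probability T R.
Variables (p d : nat) (Sig : 'M[R]_d) (A : 'M[R]_(p, d)) (B : 'M[R]_d).
Variables (S : T -> 'M[R]_d) (M v : R).
Hypothesis Spsd : forall w, psd_mx (S w).
Hypothesis Sigpsd : psd_mx Sig.
Hypothesis M1 : 1 <= M.
Hypothesis v0 : 0 <= v.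
Hypothesis hSig : forall i j, `|Sig i j| <= M.
Hypothesis hA : forall i j, `|A i j| <= M.
Hypothesis hB : forall i j, `|B i j| <= M.
Hypothesis hAA : forall i j, `|(A^T *m A) i j| <= M.
Hypothesis hS : forall i j, centered_dev P (fun w => S w i j) (Sig i j) v.

Let h1 (i j : 'I_d) : `|(1%:M : 'M[R]_d) i j| <= M.
Proof. by rewrite mxE; case: (i == j); rewrite ?normr1 ?normr0// (le_trans ler01). Qed.

Let hBT i j : `|B^T i j| <= M. Proof. by rewrite mxE. Qed.

Let s1 (i j : 'I_d) : centered_dev P (fun=> (1%:M : 'M[R]_d) i j) ((1%:M : 'M[R]_d) i j) v.
Proof. exact: centered_dev_cst. Qed.

Let K := d%:R ^+ 7 * M ^+ 4 * (88 * M ^+ 2 * v).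

Lemma gradA_bias i j :
  bias_le P (fun w => gradA (@reg R p d (S w)) A B i j) (gradA (@reg R p d Sig) A B i j) K.
Proof.
(* The terms [A S A^T A S] and [A S B^T S B S] have two and three random factors; identities fill
   the remaining places. Their two bounds [K] are compensated by the factor [2^-1]. *)
have b1 := bias_le_product i j M1 hA h1 h1 hAA h1 h1 hSig hSig s1 s1 hS hS.
have b2 := bias_le_product i j M1 hA h1 hBT hB h1 hSig hSig hSig s1 hS hS hS.
have [bm bK] := bias_leZ 2^-1 (bias_leB b1 b2).
have gE Q : psd_mx Q -> gradA (@reg R p d Q) A B i j = 2^-1 *
    ((A *m (1%:M *m (1%:M *m (1%:M *m (1%:M *m (Q *m (A^T *m A *m Q))))))) i j -
     (A *m (1%:M *m (1%:M *m (Q *m (B^T *m (Q *m (B *m Q))))))) i j).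
  move=> Qp; rewrite gradA_reg// /residual !mul1mx mxE mulmxBr mulmxBl.
  by rewrite [X in _ * X]mxE [X in _ + X]mxE !mulmxA.
rewrite gE//.
under eq_fun do rewrite (gE _ (Spsd _)).
split => //; apply: le_trans bK _.
by rewrite -/K ger0_norm ?invr_ge0//; lra.
Qed.

Lemma gradB_bias i j :
  bias_le P (fun w => gradB (@reg R p d (S w)) A B i j) (gradB (@reg R p d Sig) A B i j) K.
Proof.
(* Here the terms are [S B S A^T A S], with three random factors, and [S B S B^T S B S], which uses
   all four places. *)
have b1 := bias_le_product i j M1 h1 h1 hB hAA h1 hSig hSig hSig s1 hS hS hS.
have b2 := bias_le_product i j M1 h1 hB hBT hB hSig hSig hSig hSig hS hS hS hS.
have [bm bK] := bias_leZ (- 2^-1) (bias_leB b1 b2).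
have gE Q : psd_mx Q -> gradB (@reg R p d Q) A B i j = - 2^-1 *
    ((1%:M *m (1%:M *m (1%:M *m (Q *m (B *m (Q *m (A^T *m A *m Q))))))) i j -
     (1%:M *m (Q *m (B *m (Q *m (B^T *m (Q *m (B *m Q))))))) i j).
  move=> Qp; rewrite gradB_reg// /residual !mul1mx mxE mulmxBr mulmxBl.
  by rewrite [X in _ * X]mxE [X in _ + X]mxE !mulmxA.
rewrite gE//.
under eq_fun do rewrite (gE _ (Spsd _)).
split => //; apply: le_trans bK _.
by rewrite -/K normrN ger0_norm ?invr_ge0//; lra.
Qed.

End GradientBias.

Theorem theorem5 (R : realType) :
  exists (c : R) (k : nat), forall (p d : nat) (Sig : 'M[R]_d)
    (A : 'M[R]_(p, d)) (B : 'M[R]_d),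
  pd_mx Sig ->
  exists N : nat, forall n : nat, (N <= n)%N ->
  forall (dT : measure_display) (T : measurableType dT) (P : probability T R)
    (x : 'I_n -> T -> 'cV[R]_d),
  (forall i, gaussian_vec P (x i) Sig) -> indep_vecs P x ->
  let hatR w := reg (sample_cov (fun i => x i w)) in
  frob2 (Emx P (fun w => gradA (hatR w) A B) - gradA (@reg R p d Sig) A B)
  + frob2 (Emx P (fun w => gradB (hatR w) A B) - gradB (@reg R p d Sig) A B)
  <= c * (1 + p%:R + d%:R + frob2 Sig + frob2 A + frob2 B) ^+ k / (n%:R ^+ 2).
Proof.
pose C : R := 88 * (5 * (8 * gauss8 R + 9) ^+ 2).
(* An entry has bias at most [C * M ^+ 21 / n], where [21 = 7 + 4 + 2 + 8]: from [d%:R ^+ 7], the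
   constant matrices, the factor [M ^+ 2] of the remainder, and [v]. Squaring gives [42], and each
   gradient block has at most [M ^+ 2] entries; the leading [2] counts the blocks. *)
exists (2 * C ^+ 2), 44%N => p d Sig A B Spd.
(* The bound holds for every nonempty sample; excluding [n = 0] makes the index type ['I_n.+1], as
   [inord] requires. *)
exists 1%N => -[//|n] _ dT T P x xg ix; cbv zeta.
set M := 1 + p%:R + d%:R + frob2 Sig + frob2 A + frob2 B.
have [p0 d0] : 0 <= (p%:R : R) /\ 0 <= (d%:R : R) by split.
have [fS [fA fB]] := (frob2_ge0 Sig, (frob2_ge0 A, frob2_ge0 B)).
have M1 : 1 <= M by rewrite /M; lra.
have M0 : 0 <= M by exact: le_trans M1.
have hSig i j : `|Sig i j| <= M.
  by apply: le_trans (norm_entry_le _ _ _) _; rewrite /M; lra.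
have hA i j : `|A i j| <= M.
  by apply: le_trans (norm_entry_le _ _ _) _; rewrite /M; lra.
have hB i j : `|B i j| <= M.
  by apply: le_trans (norm_entry_le _ _ _) _; rewrite /M; lra.
have hAA i j : `|(A^T *m A) i j| <= M.
  by apply: le_trans (norm_gram_entry_le _ _ _) _; rewrite /M; lra.
pose v : R := 5 * ((8 * gauss8 R + 9) * M ^+ 4) ^+ 2 / n.+1%:R.
have v0 : 0 <= v by rewrite /v mulr_ge0 ?invr_ge0// mulr_ge0// sqr_ge0.
have hS i j : centered_dev P (fun w => sample_cov (fun i => x i w) i j) (Sig i j) v.
  exact: (sample_cov_deviation Spd xg ix M1 hSig i j).
have Sp w : psd_mx (sample_cov (fun i => x i w)) by exact: sample_cov_psd.
pose K := C * M ^+ 21 / n.+1%:R.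
have KE : d%:R ^+ 7 * M ^+ 4 * (88 * M ^+ 2 * v) <= K.
  have dM : d%:R ^+ 7 <= M ^+ 7.
    by rewrite lerXn2r ?nnegrE// /M; lra.
  have -> : K = M ^+ 7 * M ^+ 4 * (88 * M ^+ 2 * v) by rewrite /K /C /v; ring.
  apply: ler_wpM2r; first by rewrite mulr_ge0// mulr_ge0// sqr_ge0.
  by apply: ler_wpM2r => //; exact: exprn_ge0.
have subE m q (X Y : 'M[R]_(m, q)) i j : (X - Y) i j = X i j - Y i j.
  by rewrite !mxE.
have [gA gB] : (forall i j, `|(Emx P (fun w => gradA (@reg R p d (sample_cov (fun i => x i w))) A B) -
      gradA (@reg R p d Sig) A B) i j| <= K) /\
    (forall i j, `|(Emx P (fun w => gradB (@reg R p d (sample_cov (fun i => x i w))) A B) -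
      gradB (@reg R p d Sig) A B) i j| <= K).
  split=> i j; rewrite subE Emx_expect; apply: le_trans KE.
    exact: (gradA_bias Sp (pd_psd Spd) M1 v0 hSig hA hB hAA hS i j).2.
  exact: (gradB_bias Sp (pd_psd Spd) M1 v0 hSig hB hAA hS i j).2.
apply: le_trans (lerD (frob2_le gA) (frob2_le gB)) _.
have -> : 2 * C ^+ 2 * M ^+ 44 / n.+1%:R ^+ 2 = M ^+ 2 * K ^+ 2 + M ^+ 2 * K ^+ 2.
  by rewrite /K -exprVn; ring.
have [pM dM] : (p%:R <= M) /\ (d%:R <= M) by split; rewrite /M; lra.
by apply: lerD; rewrite ler_wpM2r ?sqr_ge0// expr2 ler_pM.
Qed.
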